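(* Let $(B,\Phi,\sqsubseteq)$ be a RUSQ algebra, let $M\in\mathcal{F}(\Delta)$, and let $\delta(M)=\operatorname{Tr}(\Delta,M)$ be the trace of the set of standard modules in $M$. Then $\delta(M)$ is the largest $\Delta$-semisimple submodule of $M$. Furthermore, $M/\delta(M)$ lies in $\mathcal{F}(\Delta)$. In particular, $\delta(M)$ is the largest submodule $N$ of $M$ such that $N$ is $\Delta$-semisimple and $M/N\in\mathcal{F}(\Delta)$.
   Context: All modules are finitely generated left modules over an Artin algebra $B$. Let $(\Phi,\sqsubseteq)$ be a finite poset labelling the isomorphism classes of simple $B$-modules $L_i$ ($i\in\Phi$), with projective covers $P_i$ and injective hulls $Q_i$. For a module (or class of modules) $X$ and a module $N$, the trace $\operatorname{Tr}(X,N)$ is the sum of the images of all homomorphisms to $N$ from $X$ (or from members of $X$). The standard modules are $\Delta(i)=P_i/\operatorname{Tr}\big(\bigoplus_{j\not\sqsubseteq i}P_j,P_i\big)$, and $\Delta$ denotes the set of all of them. $\mathcal{F}(\Delta)$ is the class of modules having a filtration whose factors are isomorphic to standard modules; $(N:\Delta(i))$ is the multiplicity of $\Delta(i)$ in such a filtration (well defined), and $[N:L]$ denotes composition multiplicity. $(B,\Phi,\sqsubseteq)$ is quasihereditary if for all $i\in\Phi$: $[\Delta(i):L_i]=1$; $P_i\in\mathcal{F}(\Delta)$; $(P_i:\Delta(i))=1$, and $(P_i:\Delta(j))\neq0$ implies $j\sqsupseteq i$. A quasihereditary algebra is a right ultra strongly quasihereditary (RUSQ) algebra if (A1) $\operatorname{Rad}\Delta(i)\in\mathcal{F}(\Delta)$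 for all $i\in\Phi$, and (A2) $Q_i\in\mathcal{F}(\Delta)$ for all $i\in\Phi$ with $\operatorname{Rad}\Delta(i)=0$. A module is $\Delta$-semisimple if it is a (finite) direct sum of standard modules. ''Largest'' means containing every other submodule with the stated property. *)

(* Defs.v *)
From HB Require Import structures.
From mathcomp Require Import all_boot all_order all_algebra.
From mathcomp Require Import boolp classical_sets.

Set Implicit Arguments.
Unset Strict Implicit.
Unset Printing Implicit Defensive.

Import GRing.Theory.
Local Open Scope ring_scope.

(* Modules are left modules [lmodType R]; submodules are the library's        *)
(* [submodClosed M], compared extensionally ([=i], [{subset _ <= _}]).        *)

Section Modules.
Variable R : pzRingType.
Implicit Types M N X Y : lmodType R.

Definition isomorphic M N : Prop :=
  exists f : {linear M -> N}, bijective f.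

Definition finitely_generated M : Prop :=
  exists (n : nat) (e : 'I_n -> M), forall x : M,
    exists c : 'I_n -> R, x = \sum_(i < n) c i *: e i.

Definition artinian M : Prop :=
  forall F : nat -> submodClosed M,
    (forall n, {subset F n.+1 <= F n}) ->
    exists n, forall m, (n <= m)%N -> F m =i F n.

Definition zero_submodule M (N : submodClosed M) : Prop := N =i pred1 0.

Definition whole_submodule M (N : submodClosed M) : Prop := N =i predT.

Definition simple_module M : Prop :=
  (exists x : M, x != 0) /\
  forall N : submodClosed M, zero_submodule N \/ whole_submodule N.

Definition largest M (property : submodClosed M -> Prop) (N : submodClosed M) :
    Prop :=
  property N /\ forall N' : submodClosed M, property N' -> {subset N' <= N}.

End Modules.

Section Submodule.
Variables (R : pzRingType) (M : lmodType R) (N : submodClosed M).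

Record submod := Submod { submod_val : M; _ : submod_val \in N }.

HB.instance Definition _ := [isSub of submod for submod_val].
HB.instance Definition _ := [Choice of submod by <:].
HB.instance Definition _ := [SubChoice_isSubLmodule of submod by <:].

End Submodule.

Section QuotientModule.
Variables (R : pzRingType) (M : lmodType R) (N : submodClosed M).

Definition quotmod_pred : {pred M} := fun x => x \in N.

Lemma quotmod_pred_closed : zmod_closed quotmod_pred.
Proof.
split=> [|x y xN yN]; first exact: (rpred0 N).
by rewrite -scaleN1r; apply: (rpredD xN); apply: rpredZ.
Qed.

HB.instance Definition _ := GRing.isZmodClosed.Build M quotmod_pred quotmod_pred_closed.

Definition quotmod := Quotient.quot quotmod_pred.

HB.instance Definition _ := GRing.Zmodule.on quotmod.

Local Open Scope quotient_scope.

Definition quotmod_pi (x : M) : quotmod := \pi_(Quotient.quot quotmod_pred) x.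

Definition quotmod_scale (a : R) (x : quotmod) : quotmod :=
  quotmod_pi (a *: repr x).

Lemma quotmod_piE (x y : M) : quotmod_pi x = quotmod_pi y <-> x - y \in N.
Proof.
have -> : (x - y \in N) = (x - y \in quotmod_pred) by [].
by rewrite Quotient.idealrBE; split=> [/eqP|/eqP].
Qed.

Lemma quotmod_reprK (x : quotmod) : quotmod_pi (repr x) = x.
Proof. exact: reprK. Qed.

Lemma quotmod_piD (x y : M) :
  quotmod_pi (x + y) = quotmod_pi x + quotmod_pi y.
Proof. exact: raddfD. Qed.

Lemma quotmod_piZ (a : R) (x : M) :
  quotmod_pi (a *: x) = quotmod_scale a (quotmod_pi x).
Proof.
apply/quotmod_piE; rewrite -scalerBr; apply: rpredZ.
by apply/quotmod_piE; rewrite quotmod_reprK.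
Qed.

Lemma quotmod_scaleA a b x :
  quotmod_scale a (quotmod_scale b x) = quotmod_scale (a * b) x.
Proof. by rewrite -[x]quotmod_reprK -!quotmod_piZ scalerA. Qed.

Lemma quotmod_scale0 x : quotmod_scale 0 x = 0.
Proof. by rewrite -[x]quotmod_reprK -quotmod_piZ scale0r; apply: raddf0. Qed.

Lemma quotmod_scale1 : left_id 1 quotmod_scale.
Proof. by move=> x; rewrite -[x]quotmod_reprK -quotmod_piZ scale1r. Qed.

Lemma quotmod_scaleDr : right_distributive quotmod_scale +%R.
Proof.
move=> a x y; rewrite -[x]quotmod_reprK -[y]quotmod_reprK.
by rewrite -quotmod_piD -!quotmod_piZ scalerDr quotmod_piD.
Qed.

Lemma quotmod_scaleDl x : {morph quotmod_scale^~ x : a b / a + b}.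
Proof.
move=> a b; rewrite -[x]quotmod_reprK -!quotmod_piZ scalerDl.
exact: quotmod_piD.
Qed.

HB.instance Definition _ := GRing.Zmodule_isLmodule.Build R quotmod
  quotmod_scaleA quotmod_scale1 quotmod_scaleDr quotmod_scaleDl.

Lemma quotmod_pi_linear : linear quotmod_pi.
Proof. by move=> a x y; rewrite quotmod_piD quotmod_piZ. Qed.

HB.instance Definition _ :=
  GRing.isLinear.Build R M quotmod *:%R quotmod_pi quotmod_pi_linear.

End QuotientModule.

Section Subquotient.
Variables (R : pzRingType) (M : lmodType R) (U V : submodClosed M).

Definition restrict_submod : {pred submod U} := fun x => val x \in V.

Lemma restrict_submod_closed : submod_closed restrict_submod.
Proof.
split=> [|a x y xV yV]; first by rewrite /restrict_submod unfold_in raddf0 rpred0.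
rewrite unfold_in /restrict_submod linearP.
by apply: rpredD => //; apply: rpredZ.
Qed.

HB.instance Definition _ :=
  GRing.isSubmodClosed.Build R (submod U) restrict_submod restrict_submod_closed.

(* U / (U :&: V), hence U / V when V is contained in U. *)
Definition subquot : lmodType R := quotmod restrict_submod.

End Subquotient.

Section DirectSum.
Variables (R : pzRingType) (I : finType) (V : I -> lmodType R).

Definition dsum := {dffun forall i : I, V i}.

HB.instance Definition _ := Choice.on dsum.

Definition dsum_zero : dsum := [ffun i => 0 : V i].
Definition dsum_opp (x : dsum) : dsum := [ffun i => - x i].
Definition dsum_add (x y : dsum) : dsum := [ffun i => x i + y i].
Definition dsum_scale (a : R) (x : dsum) : dsum := [ffun i => a *: x i].

Fact dsum_addA : associative dsum_add.
Proof. by move=> x y z; apply/ffunP => i; rewrite !ffunE addrA. Qed.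
Fact dsum_addC : commutative dsum_add.
Proof. by move=> x y; apply/ffunP => i; rewrite !ffunE addrC. Qed.
Fact dsum_add0 : left_id dsum_zero dsum_add.
Proof. by move=> x; apply/ffunP => i; rewrite !ffunE add0r. Qed.
Fact dsum_addN : left_inverse dsum_zero dsum_opp dsum_add.
Proof. by move=> x; apply/ffunP => i; rewrite !ffunE addNr. Qed.

HB.instance Definition _ :=
  GRing.isZmodule.Build dsum dsum_addA dsum_addC dsum_add0 dsum_addN.

Fact dsum_scaleA a b x : dsum_scale a (dsum_scale b x) = dsum_scale (a * b) x.
Proof. by apply/ffunP => i; rewrite !ffunE scalerA. Qed.
Fact dsum_scale1 : left_id 1 dsum_scale.
Proof. by move=> x; apply/ffunP => i; rewrite !ffunE scale1r. Qed.
Fact dsum_scaleDr : right_distributive dsum_scale +%R.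
Proof. by move=> a x y; apply/ffunP => i; rewrite !ffunE scalerDr. Qed.
Fact dsum_scaleDl x : {morph dsum_scale^~ x : a b / a + b}.
Proof. by move=> a b; apply/ffunP => i; rewrite !ffunE scalerDl. Qed.

HB.instance Definition _ := GRing.Zmodule_isLmodule.Build R dsum
  dsum_scaleA dsum_scale1 dsum_scaleDr dsum_scaleDl.

End DirectSum.

(* Tr(X, N) for a family X of modules; a single module is a family over unit. *)
Section Trace.
Variables (R : pzRingType) (I : Type) (X : I -> lmodType R) (N : lmodType R).

Definition in_image_of (z : N) : Prop :=
  exists (i : I) (f : {linear X i -> N}) (x : X i), z = f x.

Definition trace_pred : {pred N} := fun y =>
  `[< exists s : seq N,
        (forall z, z \in s -> in_image_of z) /\ y = \sum_(z <- s) z >].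

Lemma trace_pred_closed : submod_closed trace_pred.
Proof.
split=> [|a x y]; first by apply/asboolP; exists [::]; rewrite big_nil.
move=> /asboolP[s [sX ->]] /asboolP[t [tX ->]]; apply/asboolP.
exists ([seq a *: z | z <- s] ++ t); split; last first.
  by rewrite big_cat /= big_map scaler_sumr.
move=> z; rewrite mem_cat => /orP[/mapP[u us ->]|]; last exact: tX.
have [i [f [v ->]]] := sX _ us.
by exists i, f, (a *: v); rewrite linearZ.
Qed.

HB.instance Definition _ :=
  GRing.isSubmodClosed.Build R N trace_pred trace_pred_closed.

Definition trace : submodClosed N := trace_pred.

End Trace.

(* The Jacobson radical: the intersection of all maximal submodules. *)
Section Radical.
Variables (R : pzRingType) (M : lmodType R).

Definition maximal_submodule (N : submodClosed M) : Prop :=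
  ~ whole_submodule N /\
  forall N' : submodClosed M, {subset N <= N'} ->
    N' =i N \/ whole_submodule N'.

Definition radical_pred : {pred M} := fun x =>
  `[< forall N : submodClosed M, maximal_submodule N -> x \in N >].

Lemma radical_pred_closed : submod_closed radical_pred.
Proof.
split=> [|a x y]; first by apply/asboolP => N _; rewrite rpred0.
move=> /asboolP xR /asboolP yR; apply/asboolP => N Nmax.
by apply: rpredD; [apply/rpredZ/xR|apply: yR].
Qed.

HB.instance Definition _ :=
  GRing.isSubmodClosed.Build R M radical_pred radical_pred_closed.

Definition radical : submodClosed M := radical_pred.

End Radical.

Section Filtrations.
Variables (R : pzRingType) (I : choiceType) (X : I -> lmodType R).
Implicit Type N : lmodType R.

(* 0 = F 0 <= F 1 <= ... <= F (size s) = N with F k.+1 / F k isomorphic to    *)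
(* X applied to the k-th entry of s.                                          *)
Definition filtration N (s : seq I) : Prop :=
  exists F : nat -> submodClosed N,
    [/\ zero_submodule (F 0), whole_submodule (F (size s)) &
        forall k : 'I_(size s),
          {subset F k <= F k.+1} /\
          isomorphic (subquot (F k.+1) (F k)) (X (tnth (in_tuple s) k))].

Definition filtered N : Prop := exists s, filtration N s.

(* The number of factors X i in a chosen X-filtration of N (0 if N has none). *)
(* It does not depend on the choice when X lists pairwise non-isomorphic      *)
(* simple modules (Jordan-Hoelder: composition multiplicities) or standard    *)
(* modules.                                                                   *)
Definition multiplicity N (i : I) : nat :=
  count_mem i (xget [::] [set s | filtration N s]%classic).

Definition family_semisimple N : Prop :=
  exists (n : nat) (f : 'I_n -> I), isomorphic N (dsum (fun l => X (f l))).

End Filtrations.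

(* Projectivity and injectivity are relative to the category of finitely      *)
(* generated modules.                                                         *)
Section CoversAndHulls.
Variable R : pzRingType.
Implicit Types P Q L : lmodType R.

Definition projective P : Prop :=
  forall (M N : lmodType R) (g : {linear M -> N}) (f : {linear P -> N}),
    finitely_generated M -> finitely_generated N ->
    (forall y, exists x, g x = y) ->
    exists h : {linear P -> M}, forall x, g (h x) = f x.

Definition injective_module Q : Prop :=
  forall (M N : lmodType R) (g : {linear M -> N}) (f : {linear M -> Q}),
    finitely_generated M -> finitely_generated N ->
    injective g ->
    exists h : {linear N -> Q}, forall x, h (g x) = f x.

Definition projective_cover P L : Prop :=
  [/\ finitely_generated P, projective P &
      exists p : {linear P -> L},
        (forall y, exists x, p x = y) /\
        (* the kernel of p is superfluous *)
        (forall U : submodClosed P,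
           (forall x, exists u v, [/\ u \in U, p v = 0 & x = u + v]) ->
           whole_submodule U)].

Definition injective_hull Q L : Prop :=
  [/\ finitely_generated Q, injective_module Q &
      exists j : {linear L -> Q},
        injective j /\
        (* the image of j is essential *)
        (forall U : submodClosed Q,
           (forall x, j x \in U -> j x = 0) -> zero_submodule U)].

End CoversAndHulls.

(* B is finitely generated as a module over a commutative artinian ring k,    *)
(* through a ring morphism from k to the centre of B.                         *)
Definition artin_algebra (B : pzRingType) : Prop :=
  exists (k : comPzRingType) (eta : {rmorphism k -> B}),
    [/\ artinian (k^o : lmodType k),
        forall (c : k) (b : B), eta c * b = b * eta c &
        exists (n : nat) (e : 'I_n -> B), forall b : B,
          exists c : 'I_n -> k, b = \sum_(i < n) eta (c i) * e i].

Section QuasiHereditary.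
Variables (B : pzRingType) (d : Order.disp_t) (Phi : finPOrderType d).
Variables L P Q : Phi -> lmodType B.

Definition labels_simples : Prop :=
  [/\ forall i, simple_module (L i),
      forall i j, isomorphic (L i) (L j) -> i = j &
      forall S : lmodType B, simple_module S -> exists i, isomorphic S (L i)].

Definition Delta (i : Phi) : lmodType B :=
  quotmod (trace
    (fun _ : unit => dsum (fun j : {j : Phi | ~~ (j <= i)%O} => P (val j)))
    (P i)).

Definition quasihereditary : Prop :=
  forall i : Phi,
    [/\ multiplicity L (Delta i) i = 1%N,
        filtered Delta (P i),
        multiplicity Delta (P i) i = 1%N &
        forall j, multiplicity Delta (P i) j <> 0%N -> (i <= j)%O].

Definition RUSQ : Prop :=
  [/\ quasihereditary,
      forall i, filtered Delta (submod (radical (Delta i))) &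
      forall i, zero_submodule (radical (Delta i)) -> filtered Delta (Q i)].

End QuasiHereditary.

(* Main.v *)
Require Import Defs.
From HB Require Import structures.
From mathcomp Require Import all_boot all_order all_algebra.
From mathcomp Require Import boolp.

(* Condition (A1) makes F(Delta) closed under submodules, whence a nonzero map
   from a standard module to a module in F(Delta) is injective and every simple
   submodule of a module in F(Delta) is some L_k with Q_k in F(Delta), by (A2).
   A module in F(Delta) generated by standard modules splits off the top of its
   filtration, so that delta(M) is Delta-semisimple.
   For the quotient, Q_k has a filtration starting with some Delta(t), and every
   map from a standard module to Q_k lands in Delta(t). Let A be minimal among
   the submodules containing delta(M) with M/A in F(Delta). Every f : M -> Q_k
   maps A into Delta(t), and every map from P_i to Delta(t) factors through
   Delta(i); as the maps f separate points, every map from P_i to A factors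
   through Delta(i), and A = delta(M). *)

Set Implicit Arguments.
Unset Strict Implicit.
Unset Printing Implicit Defensive.

Import GRing.Theory.
Local Open Scope ring_scope.

(** * Submodules, exact sequences and filtrations *)

(** F(Delta) is closed under extensions and submodules but in general not under quotients, and this
    shapes the argument for M/delta(M). No filtration of that quotient is written down. Instead a
    submodule A with M/A in F(Delta) is intersected with the kernel of a map M -> Q_k/Delta(t). The
    quotient of M by the smaller submodule is an extension of M/A by a module that embeds in
    Q_k/Delta(t), so it stays in F(Delta); minimality of A then puts A inside that kernel. Minimal
    submodules require the descending chain condition. The ascending one is needed as well: it
    places proper submodules inside maximal ones and makes surjective endomorphisms injective. The
    definition of an Artin algebra only supplies a commutative artinian base ring, so both
    conditions are proved over that ring and transferred along restriction of scalars. *)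

Definition pack_linear (R : pzRingType) (M N : lmodType R) (f : M -> N)
  (h : linear f) : {linear M -> N} :=
  HB.pack f (GRing.isLinear.Build R M N *:%R f h).

(* Sealed, like [incl] and [quot_pi] below, so that simplification does not
   unfold the packed structure. *)
Fact pack_submod_subproof (R : pzRingType) (M : lmodType R) (p : {pred M}) :
  submod_closed p -> {U : submodClosed M | U =i p}.
Proof.
move=> h; pose U : submodClosed M := HB.pack p (GRing.isSubmodClosed.Build R M p h).
by exists U.
Qed.

Definition pack_submod (R : pzRingType) (M : lmodType R) (p : {pred M})
  (h : submod_closed p) : submodClosed M := sval (pack_submod_subproof h).

Lemma pack_submodE (R : pzRingType) (M : lmodType R) (p : {pred M})
  (h : submod_closed p) x : (x \in pack_submod h) = p x.
Proof. by rewrite /pack_submod; case: pack_submod_subproof. Qed.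

Definition surj (A B : Type) (f : A -> B) : Prop := forall y, exists x, f x = y.

Section Submodules.
Context {R : pzRingType}.
Implicit Types M N X Y : lmodType R.

Lemma factor_epi M N X (g : {linear M -> N}) (f : {linear M -> X}) :
  surj g -> (forall x, g x = 0 -> f x = 0) ->
  exists h : {linear N -> X}, forall x, h (g x) = f x.
Proof.
move=> gs gf; have [s sK] := choice gs.
have fE x y : g x = g y -> f x = f y.
  by move=> e; apply/subr0_eq; rewrite -linearB gf // linearB e subrr.
have hl : linear (f \o s).
  by move=> a x y /=; rewrite -linearP; apply: fE; rewrite linearP !sK.
by exists (pack_linear hl) => x; apply: fE; rewrite sK.
Qed.

Lemma factor_mono M N X (i : {linear N -> M}) (f : {linear X -> M}) :
  injective i -> (forall x, exists y, i y = f x) ->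
  exists h : {linear X -> N}, forall x, i (h x) = f x.
Proof.
move=> ii /choice[h hK].
have hl : linear h by move=> a x y; apply: ii; rewrite linearP !hK linearP.
by exists (pack_linear hl).
Qed.

Lemma inj_lin M N (f : {linear M -> N}) :
  (forall x, f x = 0 -> x = 0) -> injective f.
Proof.
move=> f0 x y e; apply/subr0_eq/f0; by rewrite linearB e subrr.
Qed.

Lemma inj_lin0 M N (f : {linear M -> N}) x : injective f -> f x = 0 -> x = 0.
Proof. by move=> fi fx; apply: fi; rewrite fx linear0. Qed.

Fact ker_closed M N (f : {linear M -> N}) : submod_closed (fun x => f x == 0).
Proof.
split=> [|a x y]; rewrite !unfold_in ?raddf0 // => /eqP fx /eqP fy.
by rewrite linearP fx fy scaler0 addr0.
Qed.

Definition ker M N (f : {linear M -> N}) : submodClosed M :=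
  pack_submod (ker_closed f).

Lemma kerP M N (f : {linear M -> N}) x : reflect (f x = 0) (x \in ker f).
Proof. by rewrite pack_submodE; apply: eqP. Qed.

Fact img_closed M N (f : {linear M -> N}) :
  submod_closed (fun y => `[< exists x, f x = y >]).
Proof.
split=> [|a x y]; first by apply/asboolP; exists 0; rewrite raddf0.
move=> /asboolP[u <-] /asboolP[v <-]; apply/asboolP.
by exists (a *: u + v); rewrite linearP.
Qed.

Definition img M N (f : {linear M -> N}) : submodClosed N :=
  pack_submod (img_closed f).

Lemma imgP M N (f : {linear M -> N}) y :
  reflect (exists x, f x = y) (y \in img f).
Proof. by rewrite pack_submodE; apply: asboolP. Qed.

Fact inv_img_closed M N (f : {linear M -> N}) (U : submodClosed N) :
  submod_closed (fun x => f x \in U).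
Proof.
split=> [|a x y xU yU]; first by change (f 0 \in U); rewrite raddf0 rpred0.
by change (f (a *: x + y) \in U); rewrite linearP rpredD // rpredZ.
Qed.

Definition inv_img M N (f : {linear M -> N}) U : submodClosed M :=
  pack_submod (inv_img_closed f U).

Lemma inv_imgE M N (f : {linear M -> N}) U x : (x \in inv_img f U) = (f x \in U).
Proof. exact: pack_submodE. Qed.

Fact capm_closed M (U V : submodClosed M) :
  submod_closed (fun x => (x \in U) && (x \in V)).
Proof.
split=> [|a x y /andP[xU xV] /andP[yU yV]]; apply/andP; first by rewrite !rpred0.
by split; apply: rpredD => //; apply: rpredZ.
Qed.

Definition capm M (U V : submodClosed M) : submodClosed M :=
  pack_submod (capm_closed U V).

Lemma capmE M (U V : submodClosed M) x :
  (x \in capm U V) = (x \in U) && (x \in V).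
Proof. exact: pack_submodE. Qed.

Fact full_closed M : submod_closed (fun x : M => true).
Proof. by []. Qed.

Definition full M : submodClosed M := pack_submod (full_closed M).

Lemma fullE M x : x \in full M. Proof. by rewrite pack_submodE. Qed.

Fact incl_subproof M (U : submodClosed M) :
  {f : {linear submod U -> M} | f =1 val}.
Proof. by exists val. Qed.

Definition incl M (U : submodClosed M) : {linear submod U -> M} :=
  sval (incl_subproof U).

Lemma inclE M (U : submodClosed M) x : incl U x = val x.
Proof. by rewrite /incl; case: incl_subproof. Qed.

Lemma incl_inj M (U : submodClosed M) : injective (incl U).
Proof. by move=> x y; rewrite !inclE => /val_inj. Qed.

Lemma incl_in M (U : submodClosed M) x : incl U x \in U.
Proof. by rewrite inclE; apply: valP. Qed.

Lemma inclP M (U : submodClosed M) x : x \in U -> exists y, incl U y = x.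
Proof. by move=> xU; exists (Submod xU); rewrite inclE. Qed.

Fact quot_pi_subproof M (U : submodClosed M) :
  {f : {linear M -> quotmod U} | surj f & forall x, f x = 0 <-> x \in U}.
Proof.
exists (quotmod_pi U) => [y|x]; first by exists (repr y); apply: quotmod_reprK.
rewrite -[X in _ = X](raddf0 (quotmod_pi U)).
by split=> [/quotmod_piE|xU]; [|apply/quotmod_piE]; rewrite subr0.
Qed.

Definition quot_pi M (U : submodClosed M) : {linear M -> quotmod U} :=
  s2val (quot_pi_subproof U).

Lemma pi_surj M (U : submodClosed M) : surj (quot_pi U).
Proof. exact: (s2valP (quot_pi_subproof U)). Qed.

Lemma pi_eq0 M (U : submodClosed M) x : quot_pi U x = 0 <-> x \in U.
Proof. exact: (s2valP' (quot_pi_subproof U)). Qed.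

Definition short_exact M N X (a : {linear N -> M}) (b : {linear M -> X}) :=
  [/\ injective a, surj b & forall x, b x = 0 <-> exists y, a y = x].

Lemma ker_exact M X (b : {linear M -> X}) :
  surj b -> short_exact (incl (ker b)) b.
Proof.
move=> bs; split=> // [|x]; first exact: incl_inj.
split=> [/kerP/inclP//|[y <-]]; exact/kerP/incl_in.
Qed.

Lemma bij_lin M N (f : {linear M -> N}) :
  injective f -> surj f -> bijective f.
Proof. by move=> fi /choice[g gK]; exists g => // x; apply: fi; rewrite gK. Qed.

Lemma inv_lin M N (f : {linear M -> N}) : injective f -> surj f ->
  exists g : {linear N -> M}, cancel f g /\ cancel g f.
Proof.
move=> fi fs; have [|g gK] := @factor_mono N M N f idfun fi; first exact: fs.
by exists g; split=> // x; apply: fi; rewrite gK.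
Qed.

Fact subquot_pi_subproof M (U V : submodClosed M) :
  {f : {linear submod U -> subquot U V} | surj f &
     forall x, f x = 0 <-> incl U x \in V}.
Proof.
exists (quot_pi (@restrict_submod R M U V : submodClosed (submod U))).
  exact: pi_surj.
by move=> x; rewrite inclE; apply: pi_eq0.
Qed.

Definition subquot_pi M (U V : submodClosed M) :
    {linear submod U -> subquot U V} :=
  s2val (subquot_pi_subproof U V).

Lemma subquot_pi_surj M (U V : submodClosed M) : surj (subquot_pi U V).
Proof. exact: (s2valP (subquot_pi_subproof U V)). Qed.

Lemma subquot_pi_eq0 M (U V : submodClosed M) x :
  subquot_pi U V x = 0 <-> incl U x \in V.
Proof. exact: (s2valP' (subquot_pi_subproof U V)). Qed.

Lemma subquot_iso M (U V : submodClosed M) Y (g : {linear submod U -> Y}) :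
  surj g -> (forall x, g x = 0 <-> incl U x \in V) -> isomorphic (subquot U V) Y.
Proof.
move=> gs g0.
have [|h hE] := factor_epi (g := subquot_pi U V) (f := g) (@subquot_pi_surj _ _ _).
  by move=> x /subquot_pi_eq0/g0.
exists h; apply: bij_lin.
  apply: inj_lin => y; have [x <-] := subquot_pi_surj y.
  by rewrite hE => /g0/subquot_pi_eq0.
by move=> y; have [x <-] := gs y; exists (subquot_pi U V x).
Qed.

End Submodules.

(** * Filtrations as an inductive predicate *)

Section Filt.
Context {R : pzRingType} {I : choiceType} {X : I -> lmodType R}.
Implicit Types M N Y : lmodType R.

(** Peels off the top factor and keeps the rest up to isomorphism, so that filtrations are treated
    by induction instead of through chains of submodules; [filtered_Filt] and [Filt_filtered] relate
    it to [filtered]. *)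
Inductive Filt : lmodType R -> Prop :=
| Filt_zero M : (forall x : M, x = 0) -> Filt M
| Filt_ext i M N (a : {linear N -> M}) (b : {linear M -> X i}) :
    short_exact a b -> Filt N -> Filt M.

Lemma Filt_iso M N (f : {linear N -> M}) :
  injective f -> surj f -> Filt N -> Filt M.
Proof.
move=> fi fs FN; have [g [fK gK]] := inv_lin fi fs.
case: FN f g fi fs fK gK => {N} [N N0|i N N' a b [ai bs ab] FN'] f g fi fs fK gK.
  by apply: Filt_zero => x; rewrite -[x]gK [g x]N0 linear0.
apply: (@Filt_ext i M N' (f \o a) (b \o g)) FN'; split=> [||x] /=.
- exact: inj_comp.
- by move=> y; have [x <-] := bs y; exists (f x); rewrite /= fK.
- rewrite ab; split=> [[y e]|[y <-]]; exists y; last by rewrite fK.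
  by rewrite e gK.
Qed.

(** Induction on the filtration of [Y]: if [e : Y -> X i] is its top factor with kernel [Y'], the
    kernel of [e \o b] is an extension of [Y'] by [N]. *)
Lemma Filt_extension M N Y (a : {linear N -> M}) (b : {linear M -> Y}) :
  short_exact a b -> Filt N -> Filt Y -> Filt M.
Proof.
move=> ab FN FY; elim: FY M a b ab => {Y} [Y Y0|i Y Y' c e [ci es ce] FY' IH] M a b [ai bs ab].
  by apply: Filt_iso ai _ FN => x; apply/ab/Y0.
have ebs : surj (e \o b).
  by move=> z; have [y <-] := es z; have [x <-] := bs y; exists x.
have [|a0 a0E] := @factor_mono _ _ _ _ (incl (ker (e \o b))) a (@incl_inj _ _ _).
  move=> x; apply/inclP/kerP => /=; suff -> : b (a x) = 0 by rewrite linear0.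
  by apply/ab; exists x.
have [|b0 b0E] := @factor_mono _ _ _ _ c (b \o incl (ker (e \o b))) ci.
  by move=> x; apply/ce; apply: (kerP _ _ (incl_in x)).
apply: Filt_ext (ker_exact ebs) _; apply: (IH _ a0 b0); split.
- by move=> x y xy; apply: ai; rewrite -!a0E xy.
- move=> y; have [x bx] := bs (c y).
  have xk : x \in ker (e \o b) by apply/kerP; rewrite /= bx; apply/ce; exists y.
  by have [z zx] := inclP xk; exists z; apply: ci; rewrite b0E /= zx.
- move=> x; split=> [x0|[y <-]].
    have /ab[y yx] : b (incl _ x) = 0 by rewrite -[b _]b0E x0 linear0.
    by exists y; apply: incl_inj; rewrite a0E.
  by apply: ci; rewrite b0E /= a0E linear0; apply/ab; exists y.
Qed.

Lemma Filt_factor i : Filt (X i).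
Proof.
have z0 (y : submod (ker (idfun : {linear X i -> X i}))) : y = 0.
  by apply: incl_inj; rewrite linear0; apply: (kerP _ _ (incl_in y)).
by apply: Filt_ext (ker_exact _) (Filt_zero z0) => y; exists y.
Qed.

Lemma filtered_Filt M : filtered X M -> Filt M.
Proof.
move=> [s [F [F0 Fs Fk]]].
have FF k : (k <= size s)%N -> Filt (submod (F k)).
  elim: k => [_|k IH ks].
    apply: Filt_zero => x; apply: incl_inj; rewrite linear0.
    by apply/eqP; rewrite -[_ == _]F0; apply: incl_in.
  have [sF [g gb]] := Fk (Ordinal ks).
  have [|a aE] := @factor_mono _ _ _ _ (incl (F k.+1)) (incl (F k)) (@incl_inj _ _ _).
    by move=> x; apply: inclP; apply: sF; apply: incl_in.
  apply: (@Filt_ext _ _ _ a (g \o subquot_pi (F k.+1) (F k))); last exact/IH/ltnW.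
  split=> [|y|x].
  - by move=> x y xy; apply: incl_inj; rewrite -!aE xy.
  - have [h _ hK] := gb; have [x xE] := subquot_pi_surj (h y).
    by exists x; rewrite /= xE hK.
  - split=> [x0|[y <-]].
      have /subquot_pi_eq0 xF := inj_lin0 (bij_inj gb) x0.
      have [y yx] := inclP xF.
      by exists y; apply: incl_inj; rewrite aE.
    rewrite /= (_ : subquot_pi _ _ _ = 0) ?linear0 //; apply/subquot_pi_eq0.
    by rewrite aE incl_in.
apply: (Filt_iso (@incl_inj _ _ (F (size s)))); last exact: FF.
by move=> x; apply: inclP; rewrite Fs.
Qed.

Lemma Filt_filtered M : Filt M -> filtered X M.
Proof.
elim=> {M} [M M0|i M N a b [ai bs ab] _ [s [F [F0 Fs Fk]]]].
  exists [::], (fun=> full M); split=> [x|x|[]//]; rewrite fullE //.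
  by apply/esym/eqP/M0.
(* The chain of [N] is carried into [M] by [a]; the new factor sits on top, hence [rcons], and every
   term past index [size s] is all of [M]. *)
pose G k := if (k <= size s)%N then img (a \o incl (F k)) else full M.
exists (rcons s i), G; split.
- move=> x; rewrite /G leq0n; apply/imgP/idP => [[y <-]|/eqP->] /=.
    by rewrite /= inE -(linear0 a) (inj_eq ai) -[_ == _]F0 incl_in.
  by exists 0; rewrite !linear0.
- by move=> x; rewrite /G size_rcons ltnn fullE.
move=> [k k_s]; rewrite (tnth_nth i) /= nth_rcons /G.
have: (k <= size s)%N by rewrite -ltnS -(size_rcons s i).
move=> {k_s} ks.
rewrite ks; case: ltngtP ks => // [ks|ks] _.
  have [sF [g gb]] := Fk (Ordinal ks).
  have sG : {subset img (a \o incl (F k)) <= img (a \o incl (F k.+1))}.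
    move=> x /imgP[y <-]; apply/imgP; have [z e] := inclP (sF _ (incl_in y)).
    by exists z; rewrite /= e.
  split=> //.
  have [|//|h hE] := @factor_mono _ _ _ _ (a \o incl (F k.+1)) (incl (img (a \o incl (F k.+1)))).
  - exact: (inj_comp ai (@incl_inj _ _ _)).
  - by move=> x; apply/imgP/incl_in.
  have hs : surj h.
    move=> y; have /inclP[z e] : a (incl _ y) \in img (a \o incl (F k.+1)).
      by apply/imgP; exists y.
    by exists z; apply: incl_inj; apply: ai; rewrite [LHS]hE.
  rewrite (tnth_nth i) /= in g gb.
  apply: (@subquot_iso _ _ _ _ _ (g \o (subquot_pi (F k.+1) (F k) \o h))).
    move=> y; have [g' _ gK] := gb; have [x xE] := subquot_pi_surj (g' y).
    have [z e] := hs x.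
    by exists z; rewrite /= e xE.
  move=> x; rewrite /=; split=> [x0|xG].
    have /subquot_pi_eq0 xF := inj_lin0 (bij_inj gb) x0.
    have [y yx] := inclP xF.
    by apply/imgP; exists y; rewrite -hE /= yx.
  rewrite (_ : subquot_pi _ _ _ = 0) ?linear0 //; apply/subquot_pi_eq0.
  have [y e] := imgP _ _ xG; move: e; rewrite -hE => /ai e.
  by rewrite -e incl_in.
split=> [x _|]; first exact: fullE.
apply: (@subquot_iso _ _ _ _ _ (b \o incl (full M))) => [y|x].
  by have [x <-] := bs y; have [z e] := inclP (fullE x); exists z; rewrite /= e.
rewrite /= ks ab; split=> [[y e]|/imgP[y <-]]; last by exists (incl _ y).
apply/imgP; have /inclP[z ez] : y \in F (size s) by rewrite Fs.
by exists z; rewrite /= ez.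
Qed.

End Filt.
Arguments Filt {R I} X _.

(** * Artinian modules over a commutative artinian ring are finitely generated *)

Section Span.
Context {R : pzRingType}.
Implicit Types M N X : lmodType R.

Lemma submodB M (U : submodClosed M) x y :
  x \in U -> y \in U -> x - y \in U.
Proof. by move=> xU yU; rewrite -scaleN1r rpredD // rpredZ. Qed.

(** Membership in the span of a list, written as a recursion that splits off one coefficient at a
    time, so that span arguments become list inductions. *)
Fixpoint lspan M (s : seq M) (x : M) : Prop :=
  if s is a :: s' then exists c, lspan s' (x - c *: a) else x = 0.

Lemma lspan0 M (s : seq M) : lspan s 0.
Proof. by elim: s => //= a s IH; exists 0; rewrite scale0r subr0. Qed.

Lemma lspanD M (s : seq M) x y : lspan s x -> lspan s y -> lspan s (x + y).
Proof.
elim: s x y => [|a s IH] x y /=; first by move=> -> ->; rewrite addr0.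
move=> [c cx] [d dy]; exists (c + d); have := IH _ _ cx dy.
by congr (lspan _ _); rewrite scalerDl opprD addrACA.
Qed.

Lemma lspan_cons M a (s : seq M) x : lspan s x -> lspan (a :: s) x.
Proof. by move=> sx; exists 0; rewrite scale0r subr0. Qed.

Lemma mem_lspan M (s : seq M) x : x \in s -> lspan s x.
Proof.
elim: s => //= a s IH; rewrite inE => /orP[/eqP<-|/IH]; last exact: lspan_cons.
by exists 1; rewrite scale1r subrr; apply: lspan0.
Qed.

Lemma lspan_sub M (s : seq M) (U : submodClosed M) x :
  {subset s <= U} -> lspan s x -> x \in U.
Proof.
elim: s x => /= [|a s IH] x sU; first by move=> ->; rewrite rpred0.
move=> [c cx]; rewrite -[x](subrK (c *: a)) rpredD //.
  by apply: IH => // y ys; apply: sU; rewrite inE ys orbT.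
by rewrite rpredZ // sU // inE eqxx.
Qed.

Lemma lspan_sum M (s : seq M) x :
  lspan s x -> exists c : nat -> R, x = \sum_(i < size s) c i *: s`_i.
Proof.
elim: s x => /= [|a s IH] x; first by move=> ->; exists (fun=> 0); rewrite big_ord0.
move=> [c /IH[d xE]]; exists (fun n => if n is n'.+1 then d n' else c).
by rewrite big_ord_recl /= -xE addrC subrK.
Qed.

Lemma lspan_cat M (s t : seq M) x y :
  lspan s x -> lspan t y -> lspan (s ++ t) (x + y).
Proof.
elim: s x => /= [|a s IH] x; first by move=> -> ; rewrite add0r.
by move=> [c cx] ty; exists c; rewrite addrAC; apply: IH.
Qed.

Lemma lspanZ M (s : seq M) b x : lspan s x -> lspan s (b *: x).
Proof.
elim: s x => /= [|a s IH] x; first by move=> ->; rewrite scaler0.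
move=> [c /IH cx]; exists (b * c); move: cx.
by rewrite scalerBr scalerA.
Qed.

Fact lspan_closed M (s : seq M) : submod_closed (fun x => `[< lspan s x >]).
Proof.
split=> [|a x y /asboolP sx /asboolP sy]; apply/asboolP; first exact: lspan0.
by apply: lspanD => //; apply: lspanZ.
Qed.

Definition lspan_submod M (s : seq M) : submodClosed M :=
  pack_submod (lspan_closed s).

Lemma lspan_submodP M (s : seq M) x : reflect (lspan s x) (x \in lspan_submod s).
Proof. by rewrite pack_submodE; apply: asboolP. Qed.

Lemma fg_lspanP M : finitely_generated M <-> exists s : seq M, forall x, lspan s x.
Proof.
split=> [[n [e eP]]|[s sP]]; last first.
  exists (size s), (fun i => s`_i) => x; have [c ->] := lspan_sum (sP x).
  by exists (fun i => c i).
exists (codom e) => x; have [c ->] := eP x.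
apply/lspan_submodP; apply: rpred_sum => i _; apply: rpredZ.
by apply/lspan_submodP/mem_lspan/codom_f.
Qed.

Lemma lspan_map M N (f : {linear M -> N}) s x : lspan s x -> lspan (map f s) (f x).
Proof.
elim: s x => /= [|a s IH] x; first by move=> ->; rewrite linear0.
by move=> [c /IH cx]; exists c; rewrite -linearZ -linearB.
Qed.

Lemma lspan_map_inv M N (f : {linear M -> N}) s y :
  lspan (map f s) y -> exists2 x, lspan s x & y = f x.
Proof.
elim: s y => /= [|a s IH] y; first by move=> ->; exists 0; rewrite ?linear0.
move=> [c /IH[x sx xE]]; exists (x + c *: a).
  by exists c; rewrite addrK.
by rewrite linearD linearZ -xE subrK.
Qed.

Lemma fg_surj M N (f : {linear M -> N}) :
  surj f -> finitely_generated M -> finitely_generated N.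
Proof.
move=> fs /fg_lspanP[s sP]; apply/fg_lspanP; exists (map f s) => y.
by have [x <-] := fs y; apply: lspan_map.
Qed.

Lemma surj_lift_seq M N (f : M -> N) (s : seq N) :
  surj f -> exists t, map f t = s.
Proof.
by move=> /choice[g gK]; exists (map g s); rewrite mapK.
Qed.

Lemma fg_extension M N X (a : {linear N -> M}) (b : {linear M -> X}) :
  short_exact a b -> finitely_generated N -> finitely_generated X ->
  finitely_generated M.
Proof.
move=> [ai bs ab] /fg_lspanP[s sP] /fg_lspanP[t tP]; apply/fg_lspanP.
have [t' tE] := surj_lift_seq t bs.
exists (t' ++ map a s) => x; have := tP (b x); rewrite -tE => /lspan_map_inv[y ty].
move=> /eqP; rewrite -subr_eq0 -linearB => /eqP/ab[z zE].
by rewrite -[x](subrK y) addrC -zE; apply: lspan_cat => //; apply: lspan_map.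
Qed.

(** Otherwise each submodule with the property strictly contains another one, and iterating a choice
    from [U0] gives a chain that never stabilises. *)
Lemma artin_min M (Pr : submodClosed M -> Prop) (U0 : submodClosed M) :
  artinian M -> Pr U0 ->
  exists2 U, Pr U & forall V, Pr V -> {subset V <= U} -> {subset U <= V}.
Proof.
move=> aM PU0; apply: contrapT => /forall2NP noU.
have nextU (U : {U | Pr U}) :
    exists V : {U | Pr U}, {subset sval V <= sval U} /\ ~ {subset sval U <= sval V}.
  case: U => U PU /=; case: (noU U) => // /existsNP[V] /not_implyP[PV].
  by move=> /not_implyP[VU UV]; exists (exist _ V PV).
have [f fP] := choice nextU.
pose F n := iter n f (exist _ U0 PU0).
have [|n nF] := aM (fun n => sval (F n)); first by move=> n; apply: (fP (F n)).1.
by apply: (fP (F n)).2 => x; rewrite -(nF n.+1).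
Qed.

End Span.

(** * Chain conditions over a commutative artinian ring *)

Section ArtinianRing.
Variable k : comPzRingType.
Hypothesis k_artin : artinian (k^o : lmodType k).
Implicit Types M : lmodType k.

Lemma subset_chain M (F : nat -> submodClosed M) m n :
  (forall n, {subset F n.+1 <= F n}) -> (m <= n)%N -> {subset F n <= F m}.
Proof.
move=> FS; elim: n => [|n IH]; first by rewrite leqn0 => /eqP->.
by rewrite leq_eqVlt => /orP[/eqP->//|/IH mn] x /FS/mn.
Qed.

(** The ideal of leading coefficients: those of [a] in the elements of [U] that lie in the span of
    [a :: s]. *)
Fact lead_closed M (a : M) s (U : submodClosed M) :
  @submod_closed k k^o (fun c => `[< exists2 y, lspan s y & c *: a + y \in U >]).
Proof.
split=> [|c x y /asboolP[u su uU] /asboolP[v sv vU]]; apply/asboolP.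
  by exists 0; [exact: lspan0|rewrite scale0r addr0 rpred0].
exists (c *: u + v); first by apply: lspanD => //; apply: lspanZ.
by rewrite scalerDl -scalerA addrACA -scalerDr rpredD ?rpredZ.
Qed.

Definition lead M (a : M) s (U : submodClosed M) : submodClosed k^o :=
  pack_submod (lead_closed a s U).

Lemma leadP M (a : M) s (U : submodClosed M) (c : k) :
  reflect (exists2 y, lspan s y & c *: a + y \in U) (c \in lead a s U).
Proof.
by rewrite (pack_submodE (lead_closed a s U) c : (c \in lead a s U) = _);
  apply: asboolP.
Qed.

(** Induction on the generators. The chain is stable once its traces on the span of [s] and its
    ideals of leading coefficients are: an [x] in [F n] has the leading coefficient of some element
    of [F m], and their difference lies in the span of [s], where [F n] and [F m] agree. *)
Lemma lspan_chain M (s : seq M) (F : nat -> submodClosed M) :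
  (forall n, {subset F n.+1 <= F n}) -> (forall x, x \in F 0%N -> lspan s x) ->
  exists n, forall m, (n <= m)%N -> F m =i F n.
Proof.
elim: s F => [|a s IH] F FS F0.
  exists 0%N => m _ x; apply/idP/idP; first exact: (subset_chain FS (leq0n m)).
  by move=> /F0 ->; rewrite rpred0.
have [n1 n1P] : exists n, forall m, (n <= m)%N ->
    capm (lspan_submod s) (F m) =i capm (lspan_submod s) (F n).
  apply: IH => [n x|x]; rewrite !capmE.
    by move=> /andP[-> /FS].
  by move=> /andP[/lspan_submodP].
have [|n2 n2P] := k_artin (F := fun n => lead a s (F n)).
  by move=> n c /leadP[y sy /FS yF]; apply/leadP; exists y.
exists (maxn n1 n2) => m nm; set n := maxn n1 n2 in nm *.
have n1n : (n1 <= n)%N by apply: leq_maxl.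
have n2n : (n2 <= n)%N by apply: leq_maxr.
move=> x; apply/idP/idP; first exact: (subset_chain FS nm).
move=> xF; have [c sc] := F0 _ (subset_chain FS (leq0n n) xF).
have : c \in lead a s (F n).
  apply/leadP; exists (x - c *: a) => //.
  by rewrite addrC subrK.
rewrite (n2P n n2n) -(n2P m (leq_trans n2n nm)) => /leadP[y sy yF].
rewrite -[x](subrK (c *: a + y)) rpredD //.
suff : x - (c *: a + y) \in capm (lspan_submod s) (F m) by rewrite capmE => /andP[].
rewrite (n1P m (leq_trans n1n nm)) -(n1P n n1n) capmE; apply/andP; split.
  by apply/lspan_submodP; rewrite opprD addrA -[- y]scaleN1r; apply: lspanD => //; apply: lspanZ.
by rewrite submodB //; apply: (subset_chain FS nm).
Qed.

Lemma fg_artinian_comm M : finitely_generated M -> artinian M.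
Proof.
by move=> /fg_lspanP[s sP] F FS; apply: (lspan_chain (s := s)).
Qed.

Definition spanned M (U : submodClosed M) :=
  exists s : seq M, forall x, x \in U <-> lspan s x.

Section Noetherian.
Variable M : lmodType k.
Hypothesis M_artin : artinian M.

Fact scale_linear (c : k) : linear (fun x : M => c *: x).
Proof. by move=> a x y; rewrite scalerDr !scalerA mulrC. Qed.

Definition scale_map (c : k) : {linear M -> M} := pack_linear (scale_linear c).

Fact principal_closed (c : k) :
  @submod_closed k k^o (fun a => `[< exists b, a = b * c >]).
Proof.
split=> [|a x y /asboolP[u ->] /asboolP[v ->]]; apply/asboolP.
  by exists 0; rewrite mul0r.
by exists (a * u + v); rewrite mulrDl -mulrA.
Qed.

Definition principal c : submodClosed k^o := pack_submod (principal_closed c).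

Lemma principalP (a c : k) : reflect (exists b, a = b * c) (a \in principal c).
Proof.
by rewrite (pack_submodE (principal_closed c) a : (a \in principal c) = _);
  apply: asboolP.
Qed.

(* On a minimal I that is not finitely generated each scalar is zero or
   invertible, so I is a vector space over a quotient of k; in an infinite
   independent sequence x_n of I, the spans of the tails x_n, x_(n+1), ...
   strictly decrease. *)
Variable I : submodClosed M.
Hypothesis I_not : ~ spanned I.
Hypothesis I_min : forall V : submodClosed M, ~ spanned V ->
  {subset V <= I} -> {subset I <= V}.

(** If neither alternative holds, the kernel and the image of [c] on [I] are proper submodules of
    [I], hence spanned by minimality; generators of the kernel and lifts of generators of the image
    then span [I]. *)
Lemma scale_min c :
  (forall x, x \in I -> c *: x = 0) \/
  (forall x, x \in I -> exists2 y, y \in I & c *: y = x).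
Proof.
apply: contrapT => /not_orP[c0 c1].
pose J1 := capm I (ker (scale_map c)).
have [s1 s1P] : spanned J1.
  apply: contrapT => /I_min IJ; apply: c0 => x xI.
  suff : x \in J1 by rewrite capmE => /andP[_ /kerP].
  by apply: IJ => // y; rewrite capmE => /andP[].
pose J2 := img (scale_map c \o incl I).
have [s2 s2P] : spanned J2.
  apply: contrapT => /I_min IJ; apply: c1 => x xI.
  have /imgP[y /= yx] : x \in J2.
    by apply: IJ => // _ /imgP[y <-] /=; rewrite rpredZ // incl_in.
  by exists (incl _ y) => //; apply: incl_in.
have [s3 s3E] : exists t : seq (submod I), map (scale_map c \o incl I) t = s2.
  have : forall x, x \in s2 -> exists y, (scale_map c \o incl I) y = x.
    by move=> x /mem_lspan/s2P/imgP.
  elim: s2 {s2P} => [_|x s IH sP]; first by exists [::].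
  have [t <-] := IH (fun y ys => sP y (mem_behead (ys : y \in behead (x :: s)))).
  by have [y <-] := sP x (mem_head _ _); exists (y :: t).
apply: I_not; exists (s1 ++ map (incl I) s3) => x; split=> [xI|]; last first.
  apply: lspan_sub => y; rewrite mem_cat => /orP[/mem_lspan/s1P|/mapP[z _ ->]].
    by rewrite capmE => /andP[].
  exact: incl_in.
have : scale_map c x \in J2.
  by have [y <-] := inclP xI; apply/imgP; exists y.
move=> /s2P; rewrite -s3E => /lspan_map_inv[y sy /= e].
rewrite -[x](subrK (incl I y)); apply: lspan_cat; last exact: lspan_map.
apply/s1P; rewrite capmE submodB ?incl_in //=; apply/kerP.
by rewrite linearB /= [scale_map c x]e subrr.
Qed.

(** The powers of [c] generate a descending chain of ideals, so [c ^+ n = d * c ^+ n.+1] for some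
    [n] and [d]. If [c] maps [I] onto itself, each [x] in [I] is a multiple [c ^+ n *: y], and [d]
    undoes [c] on it. *)
Lemma scale_inv c :
  (forall x, x \in I -> c *: x = 0) \/
  (exists d, forall x, x \in I -> d *: (c *: x) = x).
Proof.
have [c0|c1] := scale_min c; [by left|right].
have [|n nP] := k_artin (F := fun n => principal (c ^+ n)).
  by move=> n a /principalP[b ->]; apply/principalP; exists (b * c); rewrite exprS mulrA.
have : c ^+ n \in principal (c ^+ n).
  by apply/principalP; exists 1; rewrite mul1r.
rewrite -(nP n.+1) // => /principalP[d dE]; exists d => x xI.
have [y ->] : exists y, x = c ^+ n *: y.
  elim: {dE} n x xI {nP} => [|n IH] x xI; first by exists x; rewrite scale1r.
  by have [y /IH[z ->] <-] := c1 x xI; exists z; rewrite scalerA -exprS.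
by rewrite !scalerA -mulrA -exprS -dE.
Qed.

Lemma min_spanned_absurd : False.
Proof.
have next (s : seq M) : exists x, {subset s <= I} -> x \in I /\ ~ lspan s x.
  apply: contrapT => /forallNP noX; apply: I_not; exists s => x.
  have sI : {subset s <= I} by apply: contrapT => h; apply: (noX 0).
  split; last exact: lspan_sub.
  move=> xI; apply: contrapT => nx; exact: (noX x).
have {next} [nx nxP] := choice next.
pose S n := iter n (fun s => nx s :: s) [::].
have SI n : {subset S n <= I}.
  elim: n => //= n IH x; rewrite inE => /orP[/eqP->|/IH//].
  by have [] := nxP _ IH.
(* [S n] lists the first [n] chosen elements, newest first, so [T n m] holds those of index [n] to
   [n + m - 1]: a finite piece of the [n]-th tail. *)
pose T n m := take m (S (m + n)%N).
have TS n m : T n m.+1 = nx (S (m + n)%N) :: T n m by rewrite /T addSn.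
have TD n m p x : (m <= p)%N -> lspan (T n m) x -> lspan (T n p) x.
  move=> mp sx; elim: p mp => [|p IH]; first by rewrite leqn0 => /eqP<-.
  by rewrite leq_eqVlt => /orP[/eqP<-//|/IH sp]; rewrite TS; apply: lspan_cons.
have Vc n : submod_closed (fun x => `[< exists m, lspan (T n m) x >]).
  split=> [|a x y /asboolP[m1 s1] /asboolP[m2 s2]]; apply/asboolP.
    by exists 0%N; apply: lspan0.
  exists (maxn m1 m2); apply: lspanD; first apply: lspanZ.
    by apply: TD s1; apply: leq_maxl.
  by apply: TD s2; apply: leq_maxr.
have TW n m x : lspan (T n.+1 m) x -> lspan (T n m.+1) x.
  elim: m x => [|m IH] x; first by move=> ->; apply: lspan0.
  by rewrite (TS n.+1) (TS n m.+1) -addSnnS => -[c /IH cx]; exists c.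
have [|n nP] := M_artin (F := fun n => pack_submod (Vc n)).
  by move=> n x; rewrite !pack_submodE => /asboolP[m /TW sm]; apply/asboolP; exists m.+1.
(* Independence of head and tail. If the coefficient [c] of the newest tail element [z] were
   invertible on [I], [z] would lie in the span of the elements chosen before it. *)
have Tind m y : lspan (S n.+1) y -> lspan (T n.+1 m) y -> y = 0.
  move=> sy; elim: m => // m IH; rewrite TS => -[c cy].
  have SS p q x : (p <= q)%N -> lspan (S p) x -> lspan (S q) x.
    move=> pq sx; elim: q pq => [|q IHq]; first by rewrite leqn0 => /eqP<-.
    by rewrite leq_eqVlt => /orP[/eqP<-//|/IHq sp]; apply: lspan_cons.
  have TSS x : lspan (T n.+1 m) x -> lspan (S (m + n.+1)%N) x.
    move=> h; apply/lspan_submodP; apply: lspan_sub h => z /mem_take zS.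
    exact/lspan_submodP/mem_lspan.
  set z := nx _ in cy; have [zI zN] := nxP _ (SI (m + n.+1)%N).
  have [c0|[d dc]] := scale_inv c.
    by apply: IH; move: cy; rewrite c0 // subr0.
  case: zN; rewrite -/z -(dc z zI); apply: lspanZ.
  rewrite -[c *: z](subKr y) -scaleN1r; apply: lspanD; last exact/lspanZ/TSS.
  by apply: SS sy; apply: leq_addl.
(* Stability puts the [n]-th element into the span of the tail after it, so [Tind] makes it zero,
   although it was chosen outside the span of [S n]. *)
have [_] := nxP _ (SI n); case.
suff -> : nx (S n) = 0 by apply: lspan0.
have : nx (S n) \in pack_submod (Vc n).
  rewrite pack_submodE; apply/asboolP; exists 1%N; rewrite TS.
  exact/mem_lspan/mem_head.
rewrite -(nP n.+1) // pack_submodE => /asboolP[m]; apply: Tind.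
exact/mem_lspan/mem_head.
Qed.

End Noetherian.

Lemma artinian_spanned M (U : submodClosed M) : artinian M -> spanned U.
Proof.
move=> M_artin; apply: contrapT => U_not.
have [I I_not I_min] := artin_min (Pr := fun V => ~ spanned V) M_artin U_not.
exact: min_spanned_absurd M_artin I I_not I_min.
Qed.

End ArtinianRing.

(** * Finitely generated modules over an Artin algebra *)

Section RestrictionOfScalars.
Variables (k : comPzRingType) (B : pzRingType) (eta : {rmorphism k -> B}).
Variable M : lmodType B.

(** An alias, so that the [k]-module structure through [eta] can coexist with the [B]-module
    structure of [M]. *)
Definition restr : Type := M.

HB.instance Definition _ := GRing.Zmodule.on restr.

Definition restr_scale (c : k) (x : restr) : restr := eta c *: (x : M).

Fact restr_scaleA a b x : restr_scale a (restr_scale b x) = restr_scale (a * b) x.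
Proof. by rewrite /restr_scale scalerA rmorphM. Qed.
Fact restr_scale1 : left_id 1 restr_scale.
Proof. by move=> x; rewrite /restr_scale rmorph1 scale1r. Qed.
Fact restr_scaleDr : right_distributive restr_scale +%R.
Proof. by move=> a x y; rewrite /restr_scale scalerDr. Qed.
Fact restr_scaleDl x : {morph restr_scale^~ x : a b / a + b}.
Proof. by move=> a b; rewrite /restr_scale rmorphD scalerDl. Qed.

HB.instance Definition _ := GRing.Zmodule_isLmodule.Build k restr
  restr_scaleA restr_scale1 restr_scaleDr restr_scaleDl.

Fact restr_submod_closed (U : submodClosed M) :
  submod_closed (fun x : restr => (x : M) \in U).
Proof.
split=> [|a x y xU yU]; first exact: (rpred0 U).
by apply: (rpredD (S := U)) => //; apply: (rpredZ (s := U)).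
Qed.

Definition restr_submod (U : submodClosed M) : submodClosed restr :=
  pack_submod (restr_submod_closed U).

Lemma restr_submodE (U : submodClosed M) (x : M) :
  ((x : restr) \in restr_submod U) = (x \in U).
Proof. exact: pack_submodE. Qed.

Lemma restr_lspan (s : seq M) (x : M) :
  lspan (s : seq restr) x -> lspan s x.
Proof.
by elim: s x => //= a s IH x [c /IH cx]; exists (eta c).
Qed.

Hypothesis eta_fg : exists (n : nat) (e : 'I_n -> B), forall b : B,
  exists c : 'I_n -> k, b = \sum_(i < n) eta (c i) * e i.

Lemma restr_fg : finitely_generated M -> finitely_generated restr.
Proof.
have [n [e eP]] := eta_fg => -[m [f fP]]; apply/fg_lspanP.
exists ([seq e p.1 *: f p.2 | p : 'I_n * 'I_m] : seq restr) => x.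
have [c ->] := fP x; apply/lspan_submodP; apply: rpred_sum => j _.
have [d ->] := eP (c j); rewrite scaler_suml; apply: rpred_sum => i _.
rewrite -scalerA; apply: (rpredZ (d i : k)).
by apply/lspan_submodP/mem_lspan/mapP; exists (i, j); rewrite ?mem_enum.
Qed.

End RestrictionOfScalars.

Section ArtinAlgebra.
Variable B : pzRingType.
Hypothesis B_artin : artin_algebra B.
Implicit Types M N X : lmodType B.

(** [B]-submodules are [k]-submodules, and [M] is finitely generated over the artinian ring [k]. *)
Lemma fg_artinian M : finitely_generated M -> artinian M.
Proof.
have [k [eta [k_artin _ eta_fg]]] := B_artin => /(restr_fg eta_fg) Mfg F FS.
have [|n nP] := fg_artinian_comm k_artin Mfg (F := fun n => restr_submod eta (F n)).
  by move=> n x; rewrite !pack_submodE; apply: FS.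
by exists n => m nm x; have := nP m nm x; rewrite !restr_submodE.
Qed.

(** The noetherian half: a finite list spanning [U] over [k] spans it over [B] too. *)
Lemma fg_spanned M (U : submodClosed M) : finitely_generated M ->
  exists s : seq M, forall x, x \in U <-> lspan s x.
Proof.
have [k [eta [k_artin _ eta_fg]]] := B_artin => /(restr_fg eta_fg) Mfg.
have [s sP] :=
  artinian_spanned k_artin (restr_submod eta U) (fg_artinian_comm k_artin Mfg).
exists s => x; rewrite -(restr_submodE eta); split=> [/sP/restr_lspan//|].
rewrite restr_submodE; apply: lspan_sub => y ys.
by rewrite -(restr_submodE eta); apply/sP/mem_lspan.
Qed.

Lemma fg_inj M N (f : {linear N -> M}) :
  injective f -> finitely_generated M -> finitely_generated N.
Proof.
move=> fi /(fg_spanned (img f))[s sP].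
have [t tE] : exists t, map f t = s.
  have : forall x, x \in s -> exists y, f y = x.
    by move=> x /mem_lspan/sP/imgP.
  elim: s {sP} => [_|x s IH sP]; first by exists [::].
  have [|t <-] := IH; first by move=> y ys; apply: sP; rewrite inE ys orbT.
  by have [y <-] := sP x (mem_head _ _); exists (y :: t).
apply/fg_lspanP; exists t => x.
have /sP : f x \in img f by apply/imgP; exists x.
by rewrite -tE => /lspan_map_inv[y ty /fi->].
Qed.

(** The union of the chain is a submodule, and a finite list spanning it lies in a single term. *)
Lemma fg_acc M (F : nat -> submodClosed M) :
  finitely_generated M -> (forall n, {subset F n <= F n.+1}) ->
  exists n, forall m, {subset F m <= F n}.
Proof.
move=> Mfg FS.
have FSS m n : (m <= n)%N -> {subset F m <= F n}.
  elim: n => [|n IH]; first by rewrite leqn0 => /eqP->.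
  by rewrite leq_eqVlt => /orP[/eqP->//|/IH mn] x /mn/FS.
have Uc : submod_closed (fun x => `[< exists n, x \in F n >]).
  split=> [|a x y /asboolP[m xm] /asboolP[n yn]]; apply/asboolP.
    by exists 0%N; rewrite rpred0.
  exists (maxn m n); rewrite rpredD ?rpredZ //.
    exact: FSS (leq_maxl _ _) _ xm.
  exact: FSS (leq_maxr _ _) _ yn.
have [s sP] := fg_spanned (pack_submod Uc) Mfg.
have [n sn] : exists n, {subset s <= F n}.
  have : forall x, x \in s -> exists n, x \in F n.
    by move=> x /mem_lspan/sP; rewrite pack_submodE => /asboolP.
  elim: s {sP} => [_|x s IH sP]; first by exists 0%N.
  have [|n sn] := IH; first by move=> y ys; apply: sP; rewrite inE ys orbT.
  have [m xm] := sP x (mem_head _ _); exists (maxn m n) => y.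
  rewrite inE => /orP[/eqP->|/sn]; first exact: FSS (leq_maxl _ _) _ xm.
  exact: FSS (leq_maxr _ _) y.
exists n => m x xm; apply: lspan_sub sn _; apply/sP.
by rewrite pack_submodE; apply/asboolP; exists m.
Qed.

(** The kernels of the iterates of [f] stabilise at some [n]. Write [x] in the kernel of [f] as the
    [n]-th iterate at [y]; then [y] is killed by iterate [n + 1], hence by iterate [n], so
    [x = 0]. *)
Lemma fg_surj_inj M (f : {linear M -> M}) :
  finitely_generated M -> surj f -> injective f.
Proof.
move=> Mfg fs.
have kc n : submod_closed (fun x => iter n f x == 0).
  have itl : linear (iter n f).
    by elim: n => //= n IH a x y; rewrite /= IH linearP.
  split=> [|a x y /eqP x0 /eqP y0]; apply/eqP.
    exact: (linear0 (pack_linear itl)).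
  by rewrite itl x0 y0 scaler0 addr0.
have kE n x : (x \in pack_submod (kc n)) = (iter n f x == 0) by apply: pack_submodE.
have [|n nP] := fg_acc (F := fun n => pack_submod (kc n)) Mfg.
  by move=> n x; rewrite !kE /= => /eqP->; rewrite linear0.
apply: inj_lin => x fx.
have [y yx] : exists y, iter n f y = x.
  elim: {nP} n x {fx} => [|n IH] x; first by exists x.
  by have [y <-] := fs x; have [z <-] := IH y; exists z.
have : y \in pack_submod (kc n.+1) by rewrite kE /= yx fx.
by move/nP; rewrite kE yx => /eqP.
Qed.

Lemma fg_maximal M (U : submodClosed M) : finitely_generated M ->
  ~ whole_submodule U -> exists2 V, maximal_submodule V & {subset U <= V}.
Proof.
move=> Mfg U_proper; apply: contrapT => /forall2NP noV.
pose T := {V : submodClosed M | ~ whole_submodule V /\ {subset U <= V}}.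
have next (V : T) : exists W : T,
    {subset sval V <= sval W} /\ ~ {subset sval W <= sval V}.
  case: V => V [Vp UV] /=; apply: contrapT => noW.
  have [|//] := noV V; apply; split=> // W VW.
  have [Ww|Wp] := pselect (whole_submodule W); [by right|left].
  have UW : {subset U <= W} by move=> y /UV/VW.
  move=> x; apply/idP/idP; last exact: VW.
  move=> xW; apply: contrapT => /negP xV; apply: noW.
  exists (exist _ W (conj Wp UW)); split=> //= /(_ x xW).
  by apply/negP.
have [f fP] := choice next.
pose F n := iter n f (exist _ U (conj U_proper (fun x xU => xU)) : T).
have [|n nP] := fg_acc (F := fun n => sval (F n)) Mfg.
  by move=> n; apply: (fP (F n)).1.
exact: (fP (F n)).2 (nP n.+1).
Qed.

End ArtinAlgebra.

(** * Simple modules, filtrations and direct sums *)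

Section SimpleModules.
Context {R : pzRingType}.
Implicit Types M N S : lmodType R.

Lemma zero_or_nonzero M N (f : {linear M -> N}) :
  (forall x, f x = 0) \/ exists x, f x != 0.
Proof.
have [[x fx]|h] := pselect (exists x, f x != 0); first by right; exists x.
by left=> x; apply/eqP; apply: contrapT => /negP fx; apply: h; exists x.
Qed.

Lemma simple_surj M S (f : {linear M -> S}) :
  simple_module S -> (exists x, f x != 0) -> surj f.
Proof.
move=> [_ /(_ (img f))[f0|fT]] [x fx]; last by move=> y; apply/imgP; rewrite fT.
have : f x \in img f by apply/imgP; exists x.
by rewrite f0 inE (negPf fx).
Qed.

Lemma simple_inj M S (f : {linear S -> M}) :
  simple_module S -> (exists x, f x != 0) -> injective f.
Proof.
move=> [_ /(_ (ker f))[f0|fT]] [x fx].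
  by apply: inj_lin => y /kerP; rewrite f0 => /eqP.
have /kerP fx0 : x \in ker f by rewrite fT.
by rewrite fx0 eqxx in fx.
Qed.

Lemma submod_map M (U V : submodClosed M) : {subset U <= V} ->
  exists a : {linear submod U -> submod V}, forall x, incl V (a x) = incl U x.
Proof.
move=> UV; apply: factor_mono; first exact: incl_inj.
by move=> x; apply/inclP/UV/incl_in.
Qed.

Lemma corestrict M N (f : {linear M -> N}) :
  exists2 c : {linear M -> submod (img f)}, surj c & forall x, incl _ (c x) = f x.
Proof.
have [|c cE] := @factor_mono R N _ _ (incl (img f)) f (@incl_inj _ _ _).
  by move=> x; apply/inclP/imgP; exists x.
exists c => // y; have /imgP[x xE] := incl_in y.
by exists x; apply: incl_inj; rewrite cE.
Qed.

Lemma quot_simple M (V : submodClosed M) :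
  maximal_submodule V -> simple_module (quotmod V).
Proof.
move=> [Vp Vmax]; split.
  apply: contrapT => /forallNP h; apply: Vp => x; apply/idP.
  by apply/pi_eq0/eqP; apply: contrapT => /negP/h.
move=> W; have [|VW|VW] := Vmax (inv_img (quot_pi V) W).
- by move=> x /pi_eq0 xV; rewrite inv_imgE xV rpred0.
- left=> y; have [x <-] := pi_surj y; rewrite -inv_imgE VW inE.
  by apply/idP/eqP => /pi_eq0.
- right=> y; have [x <-] := pi_surj y; rewrite -inv_imgE VW //.
Qed.

Lemma ker_simple_maximal M S (f : {linear M -> S}) :
  simple_module S -> surj f -> maximal_submodule (ker f).
Proof.
move=> [[s s0] Ssimple] fs; split.
  move=> h; have [x xs] := fs s; move: s0; rewrite -xs.
  have /kerP -> : x \in ker f by rewrite h.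
  by rewrite eqxx.
move=> W kW; have [f0|fT] := Ssimple (img (f \o incl W)); [left|right] => x.
  apply/idP/idP; last exact: kW.
  move=> /inclP[y <-]; apply/kerP/eqP.
  have : f (incl W y) \in img (f \o incl W) by apply/imgP; exists y.
  by rewrite f0.
have /imgP[y /= yx] : f x \in img (f \o incl W) by rewrite fT.
rewrite -[x](subrK (incl W y)); apply/idP/rpredD; last exact: incl_in.
by apply: kW; apply/kerP; rewrite linearB yx subrr.
Qed.

End SimpleModules.

Section FiltSub.
Context {R : pzRingType} {I : choiceType} {X : I -> lmodType R}.
Implicit Types M N Y : lmodType R.

Lemma Filt_submod_eq M (U V : submodClosed M) :
  U =i V -> Filt X (submod U) -> Filt X (submod V).
Proof.
move=> UV; have [|a aE] := @submod_map _ _ U V; first by move=> x; rewrite UV.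
apply: (Filt_iso (f := a)) => [x y e|y].
  by apply: incl_inj; rewrite -!aE e.
have /inclP[x xE] : incl V y \in U by rewrite UV incl_in.
by exists x; apply: incl_inj; rewrite aE.
Qed.

Lemma Filt_img M N (f : {linear N -> M}) :
  injective f -> Filt X N <-> Filt X (submod (img f)).
Proof.
move=> fi; have [c cs cE] := corestrict f.
have ci : injective c by move=> x y e; apply: fi; rewrite -!cE e.
split; first exact: Filt_iso ci cs.
have [g [cK gK]] := inv_lin ci cs.
by apply: (Filt_iso (f := g)); [exact: can_inj gK|move=> y; exists (c y)].
Qed.

Lemma Filt_full M : Filt X (submod (full M)) <-> Filt X M.
Proof.
have s : surj (incl (full M)) by move=> x; apply/inclP/fullE.
have [g [iK gK]] := inv_lin (@incl_inj _ _ (full M)) s.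
split; first exact: Filt_iso (@incl_inj _ _ _) s.
by apply: (Filt_iso (f := g)); [exact: can_inj gK|move=> y; exists (incl _ y)].
Qed.

(** [Filt_ext] exposes the top factor only; the bottom one is found by induction, refiltering the
    quotient of [M] by the bottom factor of [N]. *)
Lemma Filt_bottom M x : x != 0 :> M -> Filt X M ->
  exists i (Y : lmodType R) (a : {linear X i -> M}) (b : {linear M -> Y}),
    short_exact a b /\ Filt X Y.
Proof.
move=> x0 FM; elim: FM x x0 => {M} [M M0|i M N a b [ai bs ab] FN IH] x x0.
  by rewrite (M0 x) eqxx in x0.
have [N0|/existsNP[y /eqP y0]] := pselect (forall y : N, y = 0).
  have bi : injective b.
    by apply: inj_lin => z /ab[y <-]; rewrite (N0 y) linear0.
  have [g [bK gK]] := inv_lin bi bs.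
  pose z : {linear M -> N} := \0.
  (* Here [b] identifies [M] with [X i], and the zero module [N] serves as the quotient. *)
  exists i, N, g, z; split; last exact: Filt_zero.
  split=> [||w]; first exact: can_inj gK.
    by move=> y; exists 0; rewrite (N0 y) linear0.
  by split=> // _; exists (b w).
have [j [Y [c [e [[ci es ce] FY]]]]] := IH y y0.
pose ac := a \o c.
have acE : short_exact ac (quot_pi (img ac)).
  split=> [||z]; [exact: inj_comp|exact: pi_surj|].
  by rewrite pi_eq0; split=> /imgP.
exists j, (quotmod (img ac)), ac, (quot_pi (img ac)); split=> //.
have [|b' b'E] := @factor_epi _ _ _ _ (quot_pi (img ac)) b (@pi_surj _ _ _).
  by move=> z /pi_eq0/imgP[w <-]; apply/ab; exists (c w).
have [|a' a'E] := @factor_epi _ _ _ _ e (quot_pi (img ac) \o a) es.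
  by move=> z /ce[w <-]; apply/pi_eq0/imgP; exists w.
apply: (Filt_ext (a := a') (b := b')) FY; split=> [|z|z].
- apply: inj_lin => z; have [w <-] := es z; rewrite a'E /= => /pi_eq0/imgP[v /ai vw].
  by apply/ce; exists v.
- by have [w <-] := bs z; exists (quot_pi (img ac) w); rewrite b'E.
- have [w <-] := pi_surj z; rewrite b'E ab; split=> [[v <-]|[v]].
    by exists (e v); rewrite a'E.
  have [u <-] := es v; rewrite a'E /= => /eqP; rewrite eq_sym -subr_eq0 -linearB.
  move=> /eqP/pi_eq0/imgP[t /= tE]; exists (u + c t).
  by rewrite linearD tE addrC subrK.
Qed.

Lemma Filt_fg M : (forall i, finitely_generated (X i)) -> Filt X M ->
  finitely_generated M.
Proof.
move=> Xfg; elim=> {M} [M M0|i M N a b ab _ Nfg].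
  by apply/fg_lspanP; exists [::] => x /=.
exact: fg_extension ab Nfg (Xfg i).
Qed.

End FiltSub.

Section DirectSums.
Context {R : pzRingType} {J : finType} {V : J -> lmodType R}.

Fact dsum_proj_linear j : linear (fun x : dsum V => x j).
Proof. by move=> a x y; rewrite !ffunE. Qed.

Definition dsum_proj j : {linear dsum V -> V j} := pack_linear (dsum_proj_linear j).

Fact dsum_inj_linear j :
  linear (fun v : V j => [ffun l => dfwith (fun l => 0 : V l) v l] : dsum V).
Proof.
move=> a x y; apply/ffunP => l; rewrite !ffunE.
have [<-|jl] := eqVneq j l; first by rewrite !dfwith_in.
by rewrite !dfwith_out // scaler0 addr0.
Qed.

Definition dsum_inj j : {linear V j -> dsum V} := pack_linear (@dsum_inj_linear j).

Lemma dsum_injE j v : dsum_inj j v j = v.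
Proof. by rewrite ffunE dfwith_in. Qed.

Lemma dsum_sum (x : dsum V) : x = \sum_j dsum_inj j (x j).
Proof.
apply/ffunP => l; rewrite -[RHS]/(dsum_proj l _) linear_sum (bigD1 l) //=.
rewrite ffunE dfwith_in big1 ?addr0 // => j jl.
by rewrite ffunE dfwith_out.
Qed.

End DirectSums.

(** * Standard modules *)

Section Standard.
Variables (B : pzRingType) (d : Order.disp_t) (Phi : finPOrderType d).
Variables L P Q : Phi -> lmodType B.
Hypothesis B_artin : artin_algebra B.
Hypothesis L_simples : labels_simples L.
Hypothesis P_cover : forall i, projective_cover (P i) (L i).
Hypothesis Q_hull : forall i, injective_hull (Q i) (L i).
Hypothesis radical_filtered :
  forall i, filtered (Delta P) (submod (radical (Delta P i))).
Hypothesis hull_filtered :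
  forall i, zero_submodule (radical (Delta P i)) -> filtered (Delta P) (Q i).
Implicit Types M N S X Y : lmodType B.

Let L_simple i : simple_module (L i). Proof. by case: L_simples. Qed.
Let P_fg i : finitely_generated (P i). Proof. by case: (P_cover i). Qed.

Lemma cover_top i : exists2 p : {linear P i -> L i}, surj p &
  forall U : submodClosed (P i), ~ whole_submodule U -> {subset U <= ker p}.
Proof.
have [_ _ [p [ps p_sup]]] := P_cover i; exists p => // U U_proper x xU.
apply/kerP; apply: contrapT => /eqP px; apply: U_proper; apply: p_sup => y.
have [z /= zy] : exists z, (p \o incl U) z = p y.
  apply: simple_surj; first exact: L_simple.
  by have [z zx] := inclP xU; exists z; rewrite /= zx.
exists (incl U z), (y - incl U z); rewrite incl_in [incl U z + _]addrC subrK; split=> //.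
by rewrite linearB zy subrr.
Qed.

Lemma L_fg i : finitely_generated (L i).
Proof. by have [p ps _] := cover_top i; apply: fg_surj ps (P_fg i). Qed.

(** The kernel of [f] is proper, hence inside [ker p], and [p] factors through [f] as a nonzero map
    [L k -> L i]. *)
Lemma cover_onto_simple i k (f : {linear P i -> L k}) :
  (exists x, f x != 0) -> i = k.
Proof.
move=> [x fx]; have fs : surj f by apply: simple_surj; [exact: L_simple|exists x].
have [p ps p_max] := cover_top i.
have [|h hE] := factor_epi (f := p) fs.
  move=> y /kerP yk; apply/kerP; apply: p_max yk => fT.
  by move/negP: fx; apply; apply/eqP/kerP; rewrite fT.
have h0 : exists y, h y != 0.
  have [[z z0] _] := L_simple i; have [y yz] := ps z.
  by exists (f y); rewrite hE yz.
apply/esym; case: L_simples => _ + _; apply; exists h; apply: bij_lin.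
  exact: simple_inj (L_simple k) h0.
exact: simple_surj (L_simple i) h0.
Qed.

(** Replaces the direct sum in the definition of [Delta] by maps from single covers [P j]; the last
    clause lets maps on [P i] descend to [Delta P i]. *)
Lemma Delta_pi i : exists pi : {linear P i -> Delta P i},
  [/\ surj pi,
      forall j (f : {linear P j -> P i}) x, ~~ (j <= i)%O -> pi (f x) = 0 &
      forall Y (g : {linear P i -> Y}),
        (forall j (f : {linear P j -> P i}) x, ~~ (j <= i)%O -> g (f x) = 0) ->
        forall x, pi x = 0 -> g x = 0].
Proof.
set T := trace (fun _ : unit =>
  dsum (fun j : {j : Phi | ~~ (j <= i)%O} => P (val j))) (P i).
exists (quot_pi T : {linear P i -> Delta P i}); split; first exact: pi_surj.
  move=> j f x ji; apply/pi_eq0/asboolP; exists [:: f x]; split; last first.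
    by rewrite big_seq1.
  move=> z; rewrite inE => /eqP->.
  pose j' : {j : Phi | ~~ (j <= i)%O} := Sub j ji.
  pose V (j : {j : Phi | ~~ (j <= i)%O}) := P (val j).
  have prK : @dsum_proj _ _ V j' (@dsum_inj _ _ V j' x) = x by apply: dsum_injE.
  exists tt, (f \o @dsum_proj _ _ V j'), (@dsum_inj _ _ V j' x).
  by rewrite -[in LHS]prK.
move=> Y g g0 x /pi_eq0/asboolP[s [sT ->]]; rewrite linear_sum big_seq big1 // => z.
move=> /sT[_ [f [y ->]]]; rewrite [y]dsum_sum !linear_sum big1 // => j _.
exact: (g0 _ (f \o @dsum_inj B _ (fun j : {j : Phi | ~~ (j <= i)%O} => P (val j)) j)
          _ (valP j)).
Qed.

Lemma Delta_fg i : finitely_generated (Delta P i).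
Proof. by have [pi [pis _ _]] := Delta_pi i; apply: fg_surj pis (P_fg i). Qed.

Let D_fg M : Filt (Delta P) M -> finitely_generated M.
Proof. exact/Filt_fg/Delta_fg. Qed.

(** By projectivity [f] lifts to a map [P j -> P i], whose image lies in the trace that is divided
    out. *)
Lemma cover_Delta0 i j (f : {linear P j -> Delta P i}) x :
  ~~ (j <= i)%O -> f x = 0.
Proof.
move=> ji; have [pi [pis pi0 _]] := Delta_pi i.
have [_ P_proj _] := P_cover j.
have [h hE] := P_proj _ _ pi f (P_fg i) (Delta_fg i) pis.
by rewrite -hE pi0.
Qed.

Lemma Delta_top i : exists2 q : {linear Delta P i -> L i}, surj q &
  forall U : submodClosed (Delta P i), ~ whole_submodule U -> {subset U <= ker q}.
Proof.
have [pi [pis _ pi_fact]] := Delta_pi i; have [p ps p_max] := cover_top i.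
have [|q qE] := factor_epi (f := p) pis.
  apply: pi_fact => j f x ji; apply: contrapT => /eqP px.
  have eji : j = i by apply: (@cover_onto_simple _ _ (p \o f)); exists x.
  by rewrite eji Order.POrderTheory.lexx in ji.
exists q => [y|U U_proper y yU].
  by have [x <-] := ps y; exists (pi x); rewrite qE.
have [x xy] := pis y; apply/kerP; rewrite -xy qE; apply/kerP.
apply: (p_max (inv_img pi U)); last by rewrite inv_imgE xy.
move=> piU; apply: U_proper => z; have [w <-] := pis z.
by rewrite -inv_imgE piU.
Qed.

Lemma Delta_nonzero i : exists x : Delta P i, x != 0.
Proof.
have [q qs _] := Delta_top i; have [[z z0] _] := L_simple i; have [x xz] := qs z.
by exists x; apply: contraNneq z0 => x0; rewrite -xz x0 linear0.
Qed.

Lemma cover_onto_Delta i k (f : {linear P i -> Delta P k}) : surj f -> i = k.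
Proof.
move=> fs; have [q qs _] := Delta_top k; apply: (@cover_onto_simple _ _ (q \o f)).
have [[z z0] _] := L_simple k; have [x xz] := qs z; have [y yx] := fs x.
by exists y; rewrite /= yx xz.
Qed.

Lemma Delta_onto_Delta i k (f : {linear Delta P i -> Delta P k}) : surj f -> i = k.
Proof.
move=> fs; have [pi [pis _ _]] := Delta_pi i.
apply: (@cover_onto_Delta _ _ (f \o pi)) => y.
by have [x <-] := fs y; have [z <-] := pis x; exists z.
Qed.

(** * Closure of F(Delta) under submodules *)

Lemma radicalE i (q : {linear Delta P i -> L i}) : surj q ->
  (forall U : submodClosed (Delta P i), ~ whole_submodule U -> {subset U <= ker q}) ->
  radical (Delta P i) =i ker q.
Proof.
move=> qs q_max; have km := ker_simple_maximal (L_simple i) qs.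
move=> x; apply/idP/idP => [/asboolP/(_ _ km)//|xk].
apply/asboolP => N [N_proper N_max].
have [|<-//|kT] := N_max (ker q); first exact: q_max.
by case: km.
Qed.

(** [Delta P i] has a unique maximal submodule, so this kernel is the radical and (A1) applies. *)
Lemma Filt_Delta_ker i S (t : {linear Delta P i -> S}) :
  simple_module S -> surj t -> Filt (Delta P) (submod (ker t)).
Proof.
move=> S_simple ts; have [q qs q_max] := Delta_top i.
have := filtered_Filt (radical_filtered i); apply: Filt_submod_eq => x.
rewrite (radicalE qs q_max).
have [t_proper t_max] := ker_simple_maximal S_simple ts.
have [|->//|kT] := t_max (ker q); first exact: q_max.
by case: (ker_simple_maximal (L_simple i) qs).
Qed.

(** Induction on the filtration. If [s] vanishes on [N], it induces [t] on the top factor, and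
    [ker s] is an extension of [ker t] by [N]. Otherwise [s] is already onto on [N], and [ker s] is
    an extension of the whole top factor by the kernel of [s \o a]. *)
Lemma Filt_ker M S (s : {linear M -> S}) : simple_module S -> surj s ->
  Filt (Delta P) M -> Filt (Delta P) (submod (ker s)).
Proof.
move=> S_simple ss FM.
elim: FM s ss => {M} [M M0|i M N a b [ai bs ab] FN IH] s ss.
  by apply: Filt_zero => x; apply: incl_inj; rewrite (M0 (incl _ x)) linear0.
have [sa0|[y sy]] := zero_or_nonzero (s \o a).
  have [|t tE] := factor_epi (f := s) bs.
    by move=> x /ab[y <-]; apply: sa0.
  have ts : surj t by move=> y; have [x <-] := ss y; exists (b x); rewrite tE.
  have [|a' a'E] := @factor_mono _ _ _ _ (incl (ker s)) a (@incl_inj _ _ _).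
    by move=> x; apply/inclP/kerP/sa0.
  have [|b' b'E] := @factor_mono _ _ _ _ (incl (ker t)) (b \o incl (ker s)) (@incl_inj _ _ _).
    by move=> x; apply/inclP/kerP; rewrite /= tE; apply/kerP/incl_in.
  apply: (Filt_extension (a := a') (b := b')) FN (Filt_Delta_ker S_simple ts).
  split=> [x y e|y|x].
  - by apply: ai; rewrite -!a'E e.
  - have [x xy] := bs (incl _ y).
    have /inclP[z zx] : x \in ker s.
      by apply/kerP; rewrite -tE xy; apply/kerP/incl_in.
    by exists z; apply: incl_inj; rewrite b'E /= zx.
  - split=> [x0|[y <-]]; last first.
      by apply: incl_inj; rewrite b'E /= a'E linear0; apply/ab; exists y.
    have /ab[y yx] : b (incl _ x) = 0 by rewrite -[b _]b'E x0 linear0.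
    by exists y; apply: incl_inj; rewrite a'E.
have sas : surj (s \o a) by apply: simple_surj => //; exists y.
have [|a' a'E] := @factor_mono _ _ _ _ (incl (ker s)) (a \o incl (ker (s \o a))) (@incl_inj _ _ _).
  by move=> x; apply/inclP/kerP; apply: (kerP _ _ (incl_in x)).
apply: (Filt_ext (a := a') (b := b \o incl (ker s))) (IH _ sas).
split=> [u v e|u|u] /=.
- by apply/incl_inj/ai; have := a'E u; rewrite e a'E.
- have [x <-] := bs u; have [w /= wx] := sas (s x).
  (* A preimage of [u] is moved into [ker s] by an element of [N] with the same value under [s]. *)
  have /inclP[z zx] : x - a w \in ker s by apply/kerP; rewrite linearB wx subrr.
  exists z; rewrite /= zx linearB (_ : b (a w) = 0) ?subr0 //.
  by apply/ab; exists w.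
- rewrite ab; split=> [[w wu]|[w <-]]; last by rewrite a'E; exists (incl _ w).
  have /inclP[z zw] : w \in ker (s \o a).
    by apply/kerP; rewrite /= wu; apply/kerP/incl_in.
  by exists z; apply: incl_inj; rewrite a'E /= zw.
Qed.

(** Take [A] minimal among the filtered submodules containing [N]. If [A] were larger than [N], a
    maximal submodule of [A] containing [N] would be filtered by [Filt_ker]. *)
Lemma Filt_submod M (N : submodClosed M) :
  Filt (Delta P) M -> Filt (Delta P) (submod N).
Proof.
move=> FM; have Mfg := D_fg FM.
have [||A [NA FA] A_min] := @artin_min _ M
  (fun A => {subset N <= A} /\ Filt (Delta P) (submod A)) (full M).
- exact: fg_artinian Mfg.
- by split=> [x _|]; [exact: fullE|exact/Filt_full].
have [AN|] := pselect ({subset A <= N}).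
  by apply: Filt_submod_eq FA => x; apply/idP/idP; [exact: AN|exact: NA].
move=> /existsNP[x /not_implyP[xA xN]]; case: notF.
have Afg : finitely_generated (submod A) by apply: D_fg.
have [|V V_max NV] := fg_maximal B_artin Afg (U := inv_img (incl A) N).
  have [y yx] := inclP xA; move=> NT; apply: xN.
  by rewrite -yx -inv_imgE NT.
have FV := Filt_ker (quot_simple V_max) (@pi_surj _ _ V) FA.
pose A' := img (incl A \o incl (ker (quot_pi V))).
have A'P y : incl A y \in A' -> y \in V.
  move=> /imgP[z /= /incl_inj <-]; apply/pi_eq0/kerP/incl_in.
have AA' : {subset A <= A'}.
  apply: A_min => [|y /imgP[z <-]]; last exact: incl_in.
  split; last first.
    have A'i : injective (incl A \o incl (ker (quot_pi V))).
      exact: inj_comp (@incl_inj _ _ _) (@incl_inj _ _ _).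
    by rewrite -(Filt_img A'i).
  move=> y yN; have [z zy] := inclP (NA y yN).
  have /inclP[w wz] : z \in ker (quot_pi V).
    by apply/kerP/pi_eq0; apply: NV; rewrite inv_imgE zy.
  by apply/imgP; exists w; rewrite /= wz.
by case: V_max => V_proper _; case: V_proper => y; rewrite A'P ?AA' ?incl_in.
Qed.

Lemma Filt_inj M N (f : {linear N -> M}) :
  injective f -> Filt (Delta P) M -> Filt (Delta P) N.
Proof. by move=> fi FM; apply/(Filt_img fi)/Filt_submod. Qed.

(** * Maps out of standard modules and into injective hulls *)

Lemma Filt_top M x : x != 0 :> M -> Filt (Delta P) M ->
  exists i N (a : {linear N -> M}) (b : {linear M -> Delta P i}),
    short_exact a b.
Proof.
move=> x0 FM; case: FM x x0 => {M} [M M0 x|i M N a b ab _ x _].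
  by rewrite (M0 x) eqxx.
by exists i, N, a, b.
Qed.

(** The image of [f] is filtered and so has a standard top factor. This factor is a quotient of
    [Delta P i], hence equal to it, and a surjective endomorphism of [Delta P i] is injective. *)
Lemma Delta_hom_inj i M (f : {linear Delta P i -> M}) :
  Filt (Delta P) M -> (exists x, f x != 0) -> injective f.
Proof.
move=> FM [x fx]; have [c cs cE] := corestrict f.
have cx : c x != 0 by apply: contraNneq fx => cx; rewrite -cE cx linear0.
have [k [N [a [b [_ bs _]]]]] := Filt_top cx (Filt_submod (img f) FM).
have bcs : surj (b \o c).
  by move=> y; have [z <-] := bs y; have [w <-] := cs z; exists w.
move: (Delta_onto_Delta bcs) => eik; subst k.
have bci := fg_surj_inj B_artin (Delta_fg i) bcs.
by move=> u v uv; apply: bci => /=; congr (b _); apply: incl_inj; rewrite !cE.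
Qed.

(** A minimal nonzero submodule is simple and filtered, hence isomorphic to its standard top factor
    [Delta P k]. The radical of that module is therefore zero, and (A2) applies to [k]. *)
Lemma Filt_simple_sub M x : x != 0 :> M -> Filt (Delta P) M ->
  exists2 k, Filt (Delta P) (Q k) & exists e : {linear L k -> M}, injective e.
Proof.
move=> x0 FM; have Mfg := D_fg FM.
have [||U [y yU y0] U_min] := @artin_min _ M
  (fun U => exists2 y, y \in U & y != 0) (full M).
- exact: fg_artinian Mfg.
- by exists x; rewrite ?fullE.
have [u uy] := inclP yU.
have u0 : u != 0 by apply: contraNneq y0 => u0; rewrite -uy u0 linear0.
have U_simple : simple_module (submod U).
  split=> [|N]; first by exists u.
  have [[z zN z0]|h] := pselect (exists2 z, z \in N & z != 0); [right|left].
    have UN : {subset U <= img (incl U \o incl N)}.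
      apply: U_min => [|_ /imgP[w <-]]; last exact: incl_in.
      exists (incl U z); last by apply: contraNneq z0 => /(inj_lin0 (@incl_inj _ _ _)) ->.
      by have [w wz] := inclP zN; apply/imgP; exists w; rewrite /= wz.
    move=> w; have /UN/imgP[v /= /incl_inj <-] := incl_in w.
    by rewrite incl_in.
  move=> z; rewrite inE; apply/idP/eqP => [zN|->]; last exact: rpred0.
  by apply: contrapT => /eqP z0; apply: h; exists z.
have [k [N [a [b [_ bs _]]]]] := Filt_top u0 (Filt_submod U FM).
have [q qs q_max] := Delta_top k.
have qbs : surj (q \o b).
  by move=> z; have [w <-] := qs z; have [v <-] := bs w; exists v.
have qbi : injective (q \o b).
  apply: simple_inj => //; have [[z z0] _] := L_simple k.
  by have [v /= vz] := qbs z; exists v; rewrite /= vz.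
exists k.
  apply: filtered_Filt; apply: hull_filtered => z; rewrite (radicalE qs q_max) inE.
  apply/kerP/eqP => [|->]; last exact: linear0.
  have [v <-] := bs z => qbv; rewrite (_ : v = 0) ?linear0 //.
  exact: inj_lin0 qbi qbv.
have [g [_ gK]] := inv_lin qbi qbs.
by exists (incl U \o g); apply: inj_comp (@incl_inj _ _ _) (can_inj gK).
Qed.

(** If nonzero, the common kernel of all these maps would contain a copy of some [L k] with [Q k]
    filtered; but the embedding of [L k] in [Q k] extends to [M]. *)
Lemma hull_separates M x : x != 0 :> M -> Filt (Delta P) M ->
  exists k (f : {linear M -> Q k}), Filt (Delta P) (Q k) /\ f x != 0.
Proof.
move=> x0 FM; apply: contrapT => no_f.
have Xc : submod_closed (fun y : M => `[< forall k (f : {linear M -> Q k}),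
    Filt (Delta P) (Q k) -> f y = 0 >]).
  split=> [|c y z /asboolP y0 /asboolP z0]; apply/asboolP => k f FQ.
    exact: linear0.
  by rewrite linearP y0 // z0 // scaler0 addr0.
have xX : x \in pack_submod Xc.
  rewrite pack_submodE; apply/asboolP => k f FQ.
  by apply: contrapT => /eqP fx; apply: no_f; exists k, f.
have [x' xx'] := inclP xX.
have x'0 : x' != 0 by apply: contraNneq x0 => x'0; rewrite -xx' x'0 linear0.
have [k FQ [e ei]] := Filt_simple_sub x'0 (Filt_submod (pack_submod Xc) FM).
have [_ Q_inj [j [ji _]]] := Q_hull k.
have [h hE] := Q_inj _ _ (incl _ \o e) j (L_fg k) (D_fg FM)
  (inj_comp (@incl_inj _ _ _) ei).
have [[z /negP z0] _] := L_simple k; apply/z0/eqP/(inj_lin0 ji).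
rewrite -hE; have := incl_in (e z); rewrite pack_submodE => /asboolP.
by apply.
Qed.

(* The image Y of g has a standard top factor, which embeds in some Q k with
   Q k filtered; extending Y -> Q k to Delta t gives a nonzero, hence injective,
   map, so that Y is itself standard. *)
Lemma cover_Delta_kill i t j (g : {linear P i -> Delta P t})
    (f : {linear P j -> P i}) x :
  ~~ (j <= i)%O -> g (f x) = 0.
Proof.
move=> ji; have [->//|[y gy]] := zero_or_nonzero g.
have [c cs cE] := corestrict g.
have cy : c y != 0 by apply: contraNneq gy => cy; rewrite -cE cy linear0.
have FD := Filt_factor t (X := Delta P).
have [m [K [a [b [_ bs _]]]]] := Filt_top cy (Filt_submod (img g) FD).
have bcs : surj (b \o c).
  by move=> z; have [w <-] := bs z; have [v <-] := cs w; exists v.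
move: (cover_onto_Delta bcs) => eim; subst m.
have [z z0] := Delta_nonzero i.
have [k [e [FQ ez]]] := hull_separates z0 (Filt_factor i).
have [_ Q_inj _] := Q_hull k.
have Yfg : finitely_generated (submod (img g)) by apply/D_fg/Filt_submod.
have [h hE] := Q_inj _ _ (incl (img g)) (e \o b) Yfg (Delta_fg t) (@incl_inj _ _ _).
have hi : injective h.
  apply: Delta_hom_inj => //; have [w wz] := bs z.
  by exists (incl _ w); rewrite hE /= wz.
(* Injectivity of [h] moves the claim to [b \o c \o f], a map from [P j] to [Delta P i]. *)
apply: hi; rewrite linear0 -cE hE /=.
by rewrite (cover_Delta0 ((b \o c) \o f) x ji : b (c (f x)) = 0) linear0.
Qed.

(* A nonzero map Delta j -> Q k / Delta t would be injective, while the
   image of Delta j in Q k meets that of Delta t, as Q k is uniform. *)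
Lemma hull_bottom k : Filt (Delta P) (Q k) ->
  exists t Y (a : {linear Delta P t -> Q k}) (b : {linear Q k -> Y}),
    [/\ short_exact a b, Filt (Delta P) Y &
        forall j (f : {linear Delta P j -> Q k}) x, b (f x) = 0].
Proof.
move=> FQ; have [_ _ [e [ei e_ess]]] := Q_hull k.
have [[z z0] _] := L_simple k.
have ez0 : e z != 0 by apply: contraNneq z0 => /(inj_lin0 ei) ->.
have [t [Y [a [b [[ai bs ab] FY]]]]] := Filt_bottom ez0 FQ.
exists t, Y, a, b; split=> // j f x.
(* [e] is essential and [L k] is simple, so every nonzero submodule of [Q k] contains the whole
   image of [e]. *)
have socle (U : submodClosed (Q k)) : (exists2 y, y \in U & y != 0) -> e z \in U.
  move=> [y yU y0].
  have [N0|NT] := (L_simple k).2 (inv_img e U); last by rewrite -inv_imgE NT.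
  case/negP: y0; rewrite -(_ : (y \in U) = (y == 0)) //.
  by rewrite e_ess // => w; rewrite -inv_imgE N0 => /eqP->; rewrite linear0.
have [bf0|[w bfw]] := zero_or_nonzero (b \o f); first exact: bf0 x.
have bfi : injective (b \o f) by apply: Delta_hom_inj => //; exists w.
have /imgP[u ue] : e z \in img f.
  apply: socle; exists (f w); first by apply/imgP; exists w.
  by apply: contraNneq bfw => /= ->; rewrite linear0.
have /imgP[v ve] : e z \in img a.
  apply: socle; have [v v0] := Delta_nonzero t.
  exists (a v); first by apply/imgP; exists v.
  by apply: contraNneq v0 => /(inj_lin0 ai) ->.
have u0 : u = 0.
  by apply: (inj_lin0 bfi) => /=; rewrite ue; apply/ab; exists v.
by rewrite -ue u0 linear0 eqxx in ez0.
Qed.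

(** * The trace of the standard modules *)

Lemma trace_sub M (U : submodClosed M) :
  (forall i (f : {linear Delta P i -> M}) x, f x \in U) ->
  {subset trace (Delta P) M <= U}.
Proof.
move=> fU x /asboolP[s [sD ->]]; rewrite big_seq; apply: rpred_sum => z /sD.
by move=> [i [f [y ->]]].
Qed.

Lemma mem_trace M i (f : {linear Delta P i -> M}) x : f x \in trace (Delta P) M.
Proof.
apply/asboolP; exists [:: f x]; rewrite big_seq1; split=> // z.
by rewrite inE => /eqP ->; exists i, f, x.
Qed.

(** A proper [U] lies in a maximal [V] with [quotmod V] isomorphic to some [L i]; the map from [P i]
    onto it lifts to [M], and the lift cannot land in [V]. *)
Lemma covers_generate M (U : submodClosed M) : finitely_generated M ->
  (forall i (f : {linear P i -> M}) x, f x \in U) -> whole_submodule U.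
Proof.
move=> Mfg fU; apply: contrapT => /(fg_maximal B_artin Mfg)[V V_max UV].
have V_simple := quot_simple V_max.
have [_ _ /(_ _ V_simple)[i [s sb]]] := L_simples.
have [g sK gK] := sb; have [p ps _] := cover_top i.
have si := bij_inj sb.
have [s' [_ s'K]] := inv_lin si (fun y => ex_intro _ (g y) (gK y)).
have [_ P_proj _] := P_cover i.
have [h hE] := P_proj _ _ (quot_pi V) (s' \o p) Mfg (fg_surj (@pi_surj _ _ V) Mfg)
  (@pi_surj _ _ V).
have [[z /negP z0] _] := L_simple i; apply/z0/eqP.
have [x xz] := ps z; rewrite -[z]s'K -xz -[s' _]hE (_ : quot_pi V _ = 0) ?linear0 //.
by apply/pi_eq0/UV.
Qed.

Lemma trace_quotient M : Filt (Delta P) M ->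
  Filt (Delta P) (quotmod (trace (Delta P) M)).
Proof.
move=> FM; set delta := trace (Delta P) M.
have Mfg := D_fg FM.
have [||A [dA FA] A_min] := @artin_min _ M
  (fun A => {subset delta <= A} /\ Filt (Delta P) (quotmod A)) (full M).
- exact: fg_artinian Mfg.
- split=> [x _|]; first exact: fullE.
  apply: Filt_zero => x; have [y <-] := pi_surj x; exact/pi_eq0/fullE.
(* [A'] competes with [A]: it contains [delta] since [b] kills the images of standard modules, and
   [beta] embeds the kernel of [quotmod A' -> quotmod A] in [Y]. *)
have A_kill k Y (f : {linear M -> Q k}) (b : {linear Q k -> Y}) :
    Filt (Delta P) Y -> (forall j (g : {linear Delta P j -> Q k}) x, b (g x) = 0) ->
    {subset A <= ker (b \o f)}.
  move=> FY bg; set A' := capm A (ker (b \o f)).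
  suff AA' : {subset A <= A'} by move=> x /AA'; rewrite capmE => /andP[].
  apply: A_min => [|x]; last by rewrite capmE => /andP[].
  split=> [x xd|].
    rewrite capmE dA //=; apply: trace_sub xd => i h y.
    by apply/kerP; apply: (bg _ (f \o h)).
  have A'P x : quot_pi A' x = 0 -> x \in A /\ b (f x) = 0.
    by move=> /pi_eq0; rewrite capmE => /andP[xA /kerP].
  have [|pi piE] := @factor_epi _ _ _ _ (quot_pi A') (quot_pi A) (@pi_surj _ _ _).
    by move=> x /A'P[xA _]; apply/pi_eq0.
  have [|beta betaE] := @factor_epi _ _ _ _ (quot_pi A') (b \o f) (@pi_surj _ _ _).
    by move=> x /A'P[].
  have pis : surj pi.
    by move=> y; have [x <-] := pi_surj y; exists (quot_pi A' x); rewrite piE.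
  apply: Filt_extension (ker_exact pis) _ FA.
  apply: (Filt_inj (f := beta \o incl (ker pi))) => //; apply: inj_lin => y /= by0.
  apply: incl_inj; rewrite linear0; move: by0 (incl_in y) => + /kerP.
  have [x <-] := pi_surj (incl (ker pi) y).
  rewrite betaE piE => bfx /pi_eq0 xA; apply/pi_eq0.
  by rewrite capmE xA; apply/kerP.
have Ad : {subset A <= delta}.
  suff h : whole_submodule (inv_img (incl A) delta).
    by move=> x /inclP[y <-]; rewrite -inv_imgE h.
  apply: covers_generate => [|i f x].
    exact: fg_inj B_artin _ _ _ (@incl_inj _ _ A) Mfg.
  have [pi [pis _ pi_fact]] := Delta_pi i.
  have [|h hE] := factor_epi (f := incl A \o f) pis.
    (* Vanishing is tested after maps [e] into filtered hulls: since [e] sends [A] into [Delta P t],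
       [e \o f] comes from a map [P i -> Delta P t], which kills the image of [g]. *)
    apply: pi_fact => j g y ji; apply: contrapT => /eqP fgy.
    have [k [e [FQ /negP]]] := hull_separates fgy FM; apply.
    have [t [Y [a [b [[ai bs ab] FY bg]]]]] := hull_bottom FQ.
    have [|g' g'E] := @factor_mono _ _ _ _ a (e \o (incl A \o f)) ai.
      move=> z; apply/ab; apply: (kerP _ _ (A_kill _ _ _ _ FY bg _ (incl_in (f z)))).
    by rewrite -[e _]g'E (cover_Delta_kill g' g) // linear0.
  by rewrite inv_imgE -[incl A _]hE; apply: mem_trace.
have [|g gE] := @factor_epi _ _ _ _ (quot_pi A) (quot_pi delta) (@pi_surj _ _ _).
  by move=> x /pi_eq0/Ad xd; apply/pi_eq0.
apply: (Filt_iso (f := g)) FA => [|y].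
  apply: inj_lin => y; have [x <-] := pi_surj y; rewrite gE => /pi_eq0/dA xA.
  exact/pi_eq0.
by have [x <-] := pi_surj y; exists (quot_pi A x).
Qed.

(** As standard modules generate [M], one of them maps under [b] outside the maximal submodule of
    the top factor. It therefore maps onto that factor, is isomorphic to it, and splits [b]. *)
Lemma generated_semisimple M : Filt (Delta P) M ->
  (forall U : submodClosed M,
    (forall i (f : {linear Delta P i -> M}) x, f x \in U) -> whole_submodule U) ->
  exists (J : finType) (f : J -> Phi), isomorphic M (dsum (fun j => Delta P (f j))).
Proof.
elim=> {M} [M M0 _|i M N a b [ai bs ab] FN IH M_gen].
  pose V (j : void) := Delta P (of_void Phi j).
  pose z : {linear M -> dsum V} := \0.
  exists void, (of_void Phi), z; apply: bij_lin => [x y _|y].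
    by rewrite (M0 x) (M0 y).
  by exists 0; apply/ffunP => -[].
have [q qs q_max] := Delta_top i.
have [j [f [x qbf]]] : exists j (f : {linear Delta P j -> M}) x, q (b (f x)) != 0.
  apply: contrapT => no_f; have /M_gen kT : forall j (f : {linear Delta P j -> M}) x,
      f x \in ker (q \o b).
    move=> j f x; apply/kerP; apply: contrapT => /eqP h; apply: no_f.
    by exists j, f, x.
  have [[z /negP z0] _] := L_simple i; apply/z0/eqP.
  have [w <-] := qs z; have [v <-] := bs w.
  by have /kerP : v \in ker (q \o b) by rewrite kT.
have bfs : surj (b \o f).
  move=> y; apply/imgP; apply: contrapT => yN.
  have img_proper : ~ whole_submodule (img (b \o f)) by move=> h; apply: yN; rewrite h.
  have /(q_max _ img_proper)/kerP h : b (f x) \in img (b \o f) by apply/imgP; exists x.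
  by rewrite h eqxx in qbf.
move: (Delta_onto_Delta bfs) => eji; subst j.
have bfi := fg_surj_inj B_artin (Delta_fg i) bfs.
have [g [bfK gK]] := inv_lin bfi bfs.
have [|r rE] := @factor_mono _ _ _ _ a (idfun \- (f \o (g \o b))) ai.
  by move=> y; apply/ab; rewrite linearB /= [b (f _)]gK subrr.
have ba y : b (a y) = 0 by apply/ab; exists y.
have rK y : r (a y) = y by apply: ai; rewrite rE /= ba !linear0 addr0.
(* [r] retracts [M] onto [N], so composing with [r] shows that standard modules generate [N] as
   well. *)
have [|J [h [phi phib]]] := IH.
  move=> U fU y; rewrite -[y]rK -inv_imgE M_gen // => j f' z.
  by rewrite inv_imgE; apply: (fU _ (r \o f')).
(* [None] indexes the summand just split off. *)
pose h' o := if o is Some j then h j else i.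
pose psi y : dsum (fun o => Delta P (h' o)) :=
  [ffun o => match o return Delta P (h' o) with
             | Some j => phi (r y) j | None => b y end].
have psi_lin : linear psi.
  move=> c y z; apply/ffunP => -[j|]; rewrite !ffunE; last exact: linearP.
  by rewrite !linearP !ffunE.
exists (option J), h', (pack_linear psi_lin); apply: bij_lin.
  apply: inj_lin => y /ffunP psi0.
  have /ab[z zy] : b y = 0 by have := psi0 None; rewrite !ffunE.
  suff z0 : z = 0 by rewrite -zy z0 linear0.
  apply: (bij_inj phib); rewrite linear0; apply/ffunP => j.
  by have := psi0 (Some j); rewrite !ffunE -zy rK.
move=> y; have [phi' _ phiK] := phib.
pose u := phi' [ffun j => y (Some j)].
pose w := a u + f (g (y None)).
have bw : b w = y None by rewrite linearD ba add0r [b (f _)]gK.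
exists w; apply/ffunP => -[j|]; rewrite ffunE; last exact: bw.
have -> : r w = u by apply: ai; rewrite rE /= bw addrK.
by rewrite phiK ffunE.
Qed.

(** The trace is filtered as a submodule of [M], and it is generated by standard modules because
    every map from one of them to [M] lands in it. *)
Lemma trace_semisimple M : Filt (Delta P) M ->
  family_semisimple (Delta P) (submod (trace (Delta P) M)).
Proof.
move=> FM; set delta := trace (Delta P) M.
have [|J [f [phi phib]]] := generated_semisimple (Filt_submod delta FM).
  move=> U fU x; suff /imgP[y /= /incl_inj <-] : incl delta x \in img (incl delta \o incl U).
    exact: incl_in.
  apply: trace_sub (incl_in x) => i h y.
  have [|h' h'E] := @factor_mono _ _ _ _ (incl delta) h (@incl_inj _ _ _).
    by move=> z; apply/inclP/mem_trace.
  have [v ve] := inclP (fU _ h' y).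
  by apply/imgP; exists v; rewrite /= ve h'E.
exists #|J|, (fun l => f (enum_val l)).
pose psi x : dsum (fun l => Delta P (f (enum_val l))) :=
  [ffun l : 'I_#|J| => phi x (enum_val l)].
have psi_lin : linear psi.
  by move=> c x y; apply/ffunP => l; rewrite !ffunE linearP !ffunE.
exists (pack_linear psi_lin); apply: bij_lin.
  apply: inj_lin => x /ffunP psi0; apply: (bij_inj phib); rewrite linear0.
  apply/ffunP => j; have := psi0 (enum_rank j); rewrite !ffunE.
  by rewrite enum_rankK.
move=> y; have [phi' _ phiK] := phib.
(* The value at [enum_rank j] has its type indexed by [enum_val (enum_rank j)]; the cast brings it
   back to [j] and disappears by uniqueness of equality proofs. *)
exists (phi' [ffun j => ecast j (Delta P (f j)) (enum_rankK j) (y (enum_rank j))]).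
apply/ffunP => l; rewrite !ffunE phiK ffunE.
move: (enum_rankK (enum_val l)); rewrite enum_valK => e.
by rewrite (eq_axiomK e).
Qed.

(** An element is the sum of its components, and each summand embeds in [M] by a map from a standard
    module. *)
Lemma semisimple_sub_trace M (N : submodClosed M) :
  family_semisimple (Delta P) (submod N) -> {subset N <= trace (Delta P) M}.
Proof.
move=> [n [f [phi phib]]] x /inclP[y <-].
have [phi' _ phiK] := phib.
have [g [phiE _]] := inv_lin (bij_inj phib) (fun y => ex_intro _ (phi' y) (phiK y)).
rewrite -[y]phiE [phi y]dsum_sum !linear_sum; apply: rpred_sum => j _.
exact: (mem_trace (incl N \o (g \o dsum_inj j))).
Qed.

End Standard.

Theorem proposition3p8 (B : pzRingType) (d : Order.disp_t)
    (Phi : finPOrderType d) (L P Q : Phi -> lmodType B)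
    (B_artin : artin_algebra B)
    (L_simples : labels_simples L)
    (P_cover : forall i, projective_cover (P i) (L i))
    (Q_hull : forall i, injective_hull (Q i) (L i))
    (B_rusq : RUSQ L P Q)
    (M : lmodType B)
    (M_fg : finitely_generated M)
    (M_filtered : filtered (Delta P) M) :
  let delta : submodClosed M := trace (Delta P) M in
  [/\ largest (fun N : submodClosed M =>
                 family_semisimple (Delta P) (submod N)) delta,
      filtered (Delta P) (quotmod delta) &
      largest (fun N : submodClosed M =>
                 family_semisimple (Delta P) (submod N) /\
                 filtered (Delta P) (quotmod N)) delta].
Proof.
have [_ rad_filtered hull_filtered] := B_rusq => delta.
have FM := filtered_Filt M_filtered.
have d_ss : family_semisimple (Delta P) (submod delta).
  exact: trace_semisimple B_artin L_simples P_cover rad_filtered _ FM.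
have d_quot : filtered (Delta P) (quotmod delta).
  by apply/Filt_filtered; apply: (trace_quotient B_artin L_simples P_cover Q_hull).
split=> //; split=> // N; first exact: semisimple_sub_trace.
by case=> /semisimple_sub_trace NM _.
Qed.
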